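(* Let $R>0$, let $P$ be a polynomial on $\mathbb{R}^n$, let $\mu$ be a finite signed Borel measure on $\mathbb{R}^n$ with support in $\overline{B_R}=\{x:|x|\le R\}$, and let $Q_P(\zeta,\theta)$ be the corresponding function of the second kind. Let $$N_P=\sup\{d(P\cdot h): h\text{ is a harmonic polynomial}\}.$$ Then the function $r\theta\mapsto r^{-(n-1)}Q_P(r,\theta)$, defined for $r>R$ and $\theta\in\mathbb{S}^{n-1}$ (that is, on $\{y\in\mathbb{R}^n:|y|>R\}$), is a polyharmonic function of polyharmonic degree $<N_P$; i.e., it is annihilated by $\Delta^{N_P}$.
   Context: Polynomials have complex coefficients and are evaluated at points $\zeta\theta\in\mathbb{C}^n$ in the obvious way. $\Delta=\sum_i\partial^2/\partial x_i^2$ ($\Delta^0$ the identity), and $h$ is harmonic if $\Delta h=0$. A smooth function $f$ has polyharmonic degree $d(f):=\min\{N\in\mathbb{N}_0:\Delta^{N+1}f=0\}$; it has polyharmonic degree $\le N$ iff $\Delta^{N+1}f=0$, and polyharmonic degree $<M$ means $\Delta^{M}f=0$. (The supremum $N_P$ is finite.) $\mathbb{S}^{n-1}$ is the unit sphere of $\mathbb{R}^n$ and $\omega_n$ its surface area. For $\theta\in\mathbb{S}^{n-1}$ and $|x|\le R$, $\zeta\mapsto r(\zeta\theta-x)$ denotes the analytic continuation to $\{\zeta\in\mathbb{C}:|\zeta|>R\}$ of $\rho\mapsto|\rho\theta-x|$, $\rho>R$; it has no zeros there. The function of the second kind is $$Q_P(\zeta,\theta)=\frac1{\omega_n}\int_{\mathbb{R}^n}\frac{P(\zeta\theta)-P(x)}{r(\zeta\theta-x)^n}\,\zeta^{n-1}\,d\mu(x),\qquad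 |\zeta|>R,\ \theta\in\mathbb{S}^{n-1}.$$ *)

(* Defs.v *)
From HB Require Import structures.
From mathcomp Require Import all_boot all_order all_algebra.
From mathcomp Require Import complex.
From mathcomp Require Import all_classical all_reals all_analysis.
From mathcomp.multinomials Require mpoly.

(* mpoly is not imported because its notations clash with those of
   MathComp-Analysis. *)

Set Implicit Arguments.
Unset Strict Implicit.
Unset Printing Implicit Defensive.

Import Order.TTheory GRing.Theory Num.Theory.
Import numFieldNormedType.Exports.

Local Open Scope classical_set_scope.
Local Open Scope ring_scope.
Local Open Scope complex_scope.

(* The library norm on 'rV[R]_n is the sup norm, whence a separate Euclidean
   norm; both norms induce the same topology. *)
Definition enorm (R : realType) (n : nat) (x : 'rV[R]_n) : R :=
  Num.sqrt (\sum_(i < n) x 0 i ^+ 2).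

Definition Gamma (R : realType) (s : R) : R :=
  (\int[@lebesgue_measure R]_(t in `]0, +oo[) (t `^ (s - 1) * expR (- t)))%R.

(* Surface area of the unit sphere of R^n, by the classical formula
   2 pi^(n/2) / Gamma(n/2). *)
Definition sphere_area (R : realType) (n : nat) : R :=
  2 * (pi `^ (n%:R / 2)) / Gamma (n%:R / 2).

Section Smooth.
Variables (R : realType) (n : nat).
Implicit Types (U : set 'rV[R]_n) (u : 'rV[R]_n -> R) (f : 'rV[R]_n -> R[i]).

Definition partial (i : 'I_n) u : 'rV[R]_n -> R :=
  fun x => 'D_(delta_mx 0 i) u x.

Fixpoint Ck_on (k : nat) U u : Prop :=
  (forall x, U x -> {for x, continuous u}) /\
  if k is k'.+1 then
    forall i : 'I_n, (forall x, U x -> derivable u x (delta_mx 0 i)) /\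
                     Ck_on k' U (partial i u)
  else True.

Definition smooth_on U f : Prop :=
  forall k, Ck_on k U (fun x => complex.Re (f x)) /\
            Ck_on k U (fun x => complex.Im (f x)).

Definition real_laplacian u : 'rV[R]_n -> R :=
  fun x => \sum_(i < n) partial i (partial i u) x.

Definition laplacian f : 'rV[R]_n -> R[i] :=
  fun x => real_laplacian (fun y => complex.Re (f y)) x
        +i* real_laplacian (fun y => complex.Im (f y)) x.

(* For U open: f is smooth on U and has polyharmonic degree < M there.  The
   values on U of the iterated Laplacian only depend on f restricted to U. *)
Definition polyharmonic_on U (M : nat) f : Prop :=
  smooth_on U f /\ forall x, U x -> iter M laplacian f x = 0.

Definition harmonic_fun f : Prop := forall x, laplacian f x = 0.

(* The default value 0 is only used when no power of the Laplacian
   annihilates f, hence never for a polynomial f. *)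
Definition polyharmonic_degree f : nat :=
  let A := [set N | forall x, iter N.+1 laplacian f x = 0] in
  xget 0%N [set N | A N /\ forall N', A N' -> (N <= N')%N].

End Smooth.

Definition cpoly (R : realType) (n : nat) := mpoly.mpoly n R[i].

Definition peval (R : realType) (n : nat) (P : cpoly R n) (z : 'I_n -> R[i])
  : R[i] := mpoly.meval z P.

Definition pfun (R : realType) (n : nat) (P : cpoly R n) (x : 'rV[R]_n) : R[i] :=
  peval P (fun i => (x 0 i)%:C).

(* sup { d(P h) : h a harmonic polynomial }, which is finite; supremum would
   return 0 for an unbounded set. *)
Definition poly_degree_sup (R : realType) (n : nat) (P : cpoly R n) : nat :=
  supremum 0%N
    [set polyharmonic_degree (fun x => pfun P x * pfun h x)
       | h in [set h : cpoly R n | harmonic_fun (pfun h)]].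

Definition borelRn (R : realType) (n : nat) :=
  g_sigma_algebraType (@open 'rV[R]_n).

Section SignedMeasure.
Context (d : measure_display) (T : measurableType d) (R : realType).
Variable mu : {charge set T -> \bar R}.

Definition hahn_pos : set T := projT1 (cid (Hahn_decomposition mu)).

Definition hahn_neg : set T :=
  projT1 (cid (projT2 (cid (Hahn_decomposition mu)))).

(* The Jordan parts below do not depend on the decomposition chosen. *)
Definition hahn_pos_neg : hahn_decomposition mu hahn_pos hahn_neg :=
  projT2 (cid (projT2 (cid (Hahn_decomposition mu)))).

Definition total_variation : set T -> \bar R := charge_variation hahn_pos_neg.

Definition charge_integral (f : T -> R) : R :=
  (\int[jordan_pos hahn_pos_neg]_x f x)%R -
  (\int[jordan_neg hahn_pos_neg]_x f x)%R.

Definition charge_cintegral (f : T -> R[i]) : R[i] :=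
  charge_integral (fun x => complex.Re (f x)) +i* charge_integral (fun x => complex.Im (f x)).

End SignedMeasure.

Definition charge_support (R : realType) (n : nat)
    (mu : {charge set (borelRn R n) -> \bar R}) : set 'rV[R]_n :=
  [set x | forall U : set 'rV[R]_n, open U -> U x ->
             (0 < total_variation mu U)%E].

Definition holomorphic_on (K : numFieldType) (D : set K) (g : K -> K) : Prop :=
  forall z, D z -> derivable g z 1.

Section SecondKind.
Variables (R : realType) (n : nat) (rad : R).

Definition is_dist_continuation (theta x : 'rV[R]_n) (g : R[i] -> R[i]) : Prop :=
  holomorphic_on (K := R[i]) [set z | rad%:C < `|z|] g /\
  forall rho : R, rad < rho -> g rho%:C = (enorm (rho *: theta - x))%:C.

(* z |-> r(z theta - x).  The continuation is unique on {|z| > rad}; it is set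
   to 0 when |x| > rad, which is irrelevant for measures supported in the
   closed ball of radius rad. *)
Definition dist_ext (theta x : 'rV[R]_n) : R[i] -> R[i] :=
  xget (fun=> 0)
    [set g | enorm x <= rad /\ is_dist_continuation theta x g].

Definition second_kind (mu : {charge set (borelRn R n) -> \bar R})
    (P : cpoly R n) (z : R[i]) (theta : 'rV[R]_n) : R[i] :=
  ((sphere_area R n)^-1)%:C *
  charge_cintegral mu (fun x : 'rV[R]_n =>
    (peval P (fun i => z * (theta 0 i)%:C) - pfun P x)
      / dist_ext theta x z ^+ n * z ^+ n.-1).

End SecondKind.

(* Main.v *)
Require Import Defs.
From mathcomp Require Import all_boot all_order all_algebra.
From mathcomp Require Import complex ring lra.
From mathcomp Require Import all_classical all_reals all_analysis measurable_realfun.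

Set Implicit Arguments.
Unset Strict Implicit.
Unset Printing Implicit Defensive.

Import Order.TTheory GRing.Theory Num.Theory.
Import numFieldNormedType.Exports.

Local Open Scope classical_set_scope.
Local Open Scope ring_scope.
Local Open Scope complex_scope.

(** The theorem rests on two facts, one algebraic and one analytic.

    Write [z = y - x], [rho = |z|], and let [N] be the supremum in the theorem,
    so that [Delta^(N+1) (P h) = 0] for every harmonic polynomial [h].  Dividing
    by [|y|^(n-1)], the function in question is, up to a constant, the integral
    over the ball of the kernel [u = (P(y) - P(x)) rho^(-n)], and it is enough to
    show that [v = Delta^N u] vanishes for [y <> x] ([kernel_polyharmonic]).  At a
    given point a harmonic function has the same jet, to any finite order, as a harmonic
    polynomial, namely its Taylor polynomial, so that [Delta^(N+1) (P h) = 0] for every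
    function [h] harmonic off [x] ([harmonic_transfer]).  The functions
    [z_i rho^(-n)] and [rho^(2-n)] are harmonic, hence
    [Delta^(N+1) (z_i u) = 0] and [Delta^(N+1) (rho^2 u) = 0].  The commutator
    identity [Delta^M (z_i w) = z_i Delta^M w + 2 M d_i Delta^(M-1) w]
    ([klapn_coord]), applied to [w = z_i u] and summed over [i], turns these into
    [sum_i d_i Delta^N (z_i u) = 0]; applied once more, to [u], it gives
    [(E + n + 2 N) v = 0], where [E = sum_i z_i d_i] is the Euler operator.  But
    [P(y) - P(x)] is a sum of polynomials homogeneous of positive degrees [m] in
    [z], so that [v] is a sum of functions homogeneous of degrees [m - n - 2 N],
    and such a sum is killed by [E + n + 2 N] only if it is zero
    ([graded_eigen0]).

    On the analytic side, all kernels involved are polynomial expressions in the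
    coordinates of [y] and [x] and in [1 / rho], a class that is stable under
    differentiation in [y].  Such an expression is bounded and equicontinuous in
    [y], uniformly for [|x| <= R] ([kev_equicontinuous]), so that its integral may
    be differentiated under the integral sign ([is_derive_kint]), and therefore
    indefinitely.

    It remains to identify the integrand.  The continuation of the distance
    exists, being [z sqrt(1 - a/z) sqrt(1 - a'/z)] with [a], [a'] the roots of
    [z^2 - 2 <theta, x> z + |x|^2], and it takes the value [|y - x|] at
    [z = |y|], [theta = y / |y|] ([dist_extE]).  The degrees whose supremum is
    taken are bounded, because multiplying by a polynomial raises the
    polyharmonic degree by a bounded amount ([kpoly_degree_bound]); hence the
    supremum is an upper bound ([poly_degree_supP]).  Real and imaginary parts of
    [P] are treated separately. *)

(** * The Euclidean norm and derivatives along lines *)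

Section EuclideanNorm.
Variables (R : realType) (n : nat).
Implicit Types (x y z : 'rV[R]_n).

Lemma enorm_ge0 x : 0 <= enorm x.
Proof. exact: sqrtr_ge0. Qed.

Lemma sqr_enorm x : enorm x ^+ 2 = \sum_i x 0 i ^+ 2.
Proof. by rewrite sqr_sqrtr// sumr_ge0// => i _; exact: sqr_ge0. Qed.

Lemma enorm_eq0 x : (enorm x == 0) = (x == 0).
Proof.
apply/idP/idP => [|/eqP->]; last first.
  by rewrite -sqrf_eq0 sqr_enorm big1// => i _; rewrite mxE expr0n.
rewrite -sqrf_eq0 sqr_enorm psumr_eq0; last by move=> i _; exact: sqr_ge0.
move=> /allP x0; apply/eqP/rowP => i; rewrite mxE; apply/eqP.
by have := x0 i (mem_index_enum i); rewrite /= sqrf_eq0.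
Qed.

Lemma enorm_gt0 x : (0 < enorm x) = (x != 0).
Proof. by rewrite lt_def enorm_ge0 enorm_eq0 andbT. Qed.

Lemma enormN x : enorm (- x) = enorm x.
Proof. by congr Num.sqrt; apply: eq_bigr => i _; rewrite mxE sqrrN. Qed.

Lemma enormD x y : enorm (x + y) <= enorm x + enorm y.
Proof.
have [->|x0] := eqVneq x 0; first by rewrite add0r lerDr enorm_ge0.
have [->|y0] := eqVneq y 0; first by rewrite addr0 lerDl enorm_ge0.
have px : 0 < enorm x by rewrite enorm_gt0.
have py : 0 < enorm y by rewrite enorm_gt0.
rewrite -(@ler_pXn2r _ 2) ?nnegrE ?enorm_ge0 ?addr_ge0 ?enorm_ge0//.
rewrite sqrrD.
have -> : enorm (x + y) ^+ 2 =
    enorm x ^+ 2 + 2 * (\sum_i x 0 i * y 0 i) + enorm y ^+ 2.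
  rewrite !sqr_enorm big_distrr/= -!big_split; apply: eq_bigr => i _ /=.
  by rewrite !mxE; ring.
rewrite lerD2r lerD2l -[leRHS]mulr_natl ler_pM2l//.
have cs : \sum_i (x 0 i / enorm x) * (y 0 i / enorm y) <= 1.
  apply: (@le_trans _ _ (\sum_i 2^-1 * ((x 0 i / enorm x) ^+ 2 +
      (y 0 i / enorm y) ^+ 2))).
    apply: ler_sum => i _; rewrite -subr_ge0.
    set u := _ / _; set v := _ / _.
    have -> : 2^-1 * (u ^+ 2 + v ^+ 2) - u * v = 2^-1 * (u - v) ^+ 2 by field.
    by rewrite mulr_ge0// sqr_ge0.
  rewrite -big_distrr big_split/=.
  under eq_bigr do rewrite exprMn.
  under [X in _ + X]eq_bigr do rewrite exprMn.
  rewrite -!big_distrl/= -!sqr_enorm !exprVn !divff ?sqrf_eq0 ?gt_eqF//.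
  by lra.
rewrite -[leRHS]mul1r -ler_pdivrMr ?mulr_gt0// (le_trans _ cs)// big_distrl/=.
rewrite le_eqVlt; apply/orP; left; apply/eqP; apply: eq_bigr => i _.
by field; rewrite !gt_eqF.
Qed.

Lemma enormB_ge x y : enorm x - enorm y <= enorm (x - y).
Proof. by rewrite lerBlDr; have := enormD (x - y) y; rewrite subrK. Qed.

Lemma enorm_dist_le x y : `|enorm x - enorm y| <= enorm (x - y).
Proof.
rewrite ler_norml enormB_ge andbT lerNl opprB.
by rewrite -[enorm (x - y)]enormN opprB enormB_ge.
Qed.

Lemma enorm_continuous : continuous (@enorm R n).
Proof.
move=> x; apply: continuous_comp; last exact: sqrt_continuous.
move: x; apply: (@continuous_big _ _ +%R 0 xpredT); first exact: add_continuous.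
move=> i _ x.
exact: (continuous_comp (@coord_continuous R 1 n 0 i x) (@exprn_continuous R 2 _)).
Qed.

Lemma near_enorm_lt y (e : R) : 0 < e -> \forall z \near y, enorm (z - y) < e.
Proof.
move=> e0; have c : {for y, continuous (fun z => enorm (z - y))}.
  apply: (@continuous_comp _ _ _ (fun z => z - y) (@enorm R n)).
    by apply: (@continuousB _ _ _ (fun z => z) (fun=> y));
      [exact: cvg_id|exact: cst_continuous].
  exact: enorm_continuous.
have /cvgrPdist_lt /(_ e e0) := c; apply: filterS => z.
rewrite subrr (eqP (_ : enorm (0 : 'rV[R]_n) == 0)) ?enorm_eq0//.
by rewrite sub0r normrN ger0_norm// enorm_ge0.
Qed.

Lemma open_outside (rad : R) : open [set y : 'rV[R]_n | rad < enorm y].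
Proof.
rewrite (_ : mkset _ = @enorm R n @^-1` [set t | rad < t])//.
apply: open_comp; last exact: open_gt.
by move=> x _; exact: enorm_continuous.
Qed.

Lemma near_neq x y : y != x -> \forall z \near y, z != x.
Proof.
move=> yx; apply/nbhs_ballP; exists `|y - x|.
  by rewrite /= normr_gt0 subr_eq0.
by move=> z; rewrite -ball_normE /=; apply: contraTneq => ->; rewrite ltxx.
Qed.

Lemma near_outside (rad : R) y : rad < enorm y ->
  \forall z \near y, rad < enorm z.
Proof.
by move=> ry; apply: open_nbhs_nbhs; split; [exact: open_outside|exact: ry].
Qed.

Lemma outside_neq (rad : R) x y : enorm x <= rad -> rad < enorm y -> y != x.
Proof. by move=> xr; apply: contraTneq => ->; rewrite -leNgt. Qed.

(** The directional derivative is computed on the line through [y], where the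
    chain rule for real functions of one variable applies. *)
Lemma is_derive_line (f : 'rV[R]_n -> R) (v y : 'rV[R]_n) (df : R) :
  is_derive (0 : R) 1 (fun t : R => f (t *: v + y)) df -> is_derive y v f df.
Proof.
move=> [d1 d2]; split; first by case: (derivable1P f y v) => _; apply.
rewrite -d2 /derive; set g1 := fun h => h^-1 *: _; set g2 := fun h => h^-1 *: _.
suff -> : g1 = g2 by [].
by rewrite /g1 /g2; apply/funext => h /=; rewrite addr0 scale0r add0r [_%:A]mulr1.
Qed.

Lemma is_derive_restr_line (f : 'rV[R]_n -> R) (v y : 'rV[R]_n) (t df : R) :
  is_derive (t *: v + y) v f df -> is_derive t 1 (fun t : R => f (t *: v + y)) df.
Proof.
have E : (fun h : R => h^-1 *: (f (h *: v + (t *: v + y)) - f (t *: v + y))) =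
    (fun h : R => h^-1 *: (f ((h *: 1 + t) *: v + y) - f (t *: v + y))).
  by apply/funext => h; rewrite [_%:A]mulr1 scalerDl addrA.
move=> [d1 d2]; split; first by move: d1; rewrite /derivable/= E.
by move: d2; rewrite /derive /= E.
Qed.

End EuclideanNorm.

(** * Kernels and their formal derivatives *)

Section Kernels.
Variables (R : realType) (n : nat).
Implicit Types (x y z : 'rV[R]_n) (i j : 'I_n).

(** Functions of [y] with a parameter [x], given by expressions: formal
    differentiation then provides the derivatives of all orders in [y], and
    each of them again depends on [x] in a controlled way.  [KY i] and [KX i] are
    the coordinates of [y] and [x], and [KInv] is [1 / |y - x|]. *)
Inductive kexpr : Type :=
| KConst of R
| KY of 'I_n
| KX of 'I_n
| KInv
| KAdd of kexpr & kexpr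
| KMul of kexpr & kexpr.

Implicit Types (e u v w : kexpr).

Fixpoint kev e x y : R :=
  match e with
  | KConst c => c
  | KY i => y 0 i
  | KX i => x 0 i
  | KInv => (enorm (y - x))^-1
  | KAdd e1 e2 => kev e1 x y + kev e2 x y
  | KMul e1 e2 => kev e1 x y * kev e2 x y
  end.

Definition kscale c e := KMul (KConst c) e.
Definition kz i := KAdd (KY i) (kscale (-1) (KX i)).
Definition ksum (F : 'I_n -> kexpr) := \big[KAdd/KConst 0]_(i < n) F i.
Fixpoint kinvn (k : nat) :=
  if k is k'.+1 then KMul KInv (kinvn k') else KConst 1.

Fixpoint kpd i e : kexpr :=
  match e with
  | KConst _ => KConst 0
  | KY j => KConst (i == j)%:R
  | KX j => KConst 0
  | KInv => kscale (-1) (KMul (kz i) (kinvn 3))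
  | KAdd e1 e2 => KAdd (kpd i e1) (kpd i e2)
  | KMul e1 e2 => KAdd (KMul (kpd i e1) e2) (KMul e1 (kpd i e2))
  end.

Definition klap e := ksum (fun i => kpd i (kpd i e)).

Lemma kev_sum F x y : kev (ksum F) x y = \sum_i kev (F i) x y.
Proof. exact: (big_morph (fun e => kev e x y)). Qed.

Lemma kpd_sum i F : kpd i (ksum F) = ksum (fun j => kpd i (F j)).
Proof. exact: (big_morph (kpd i)). Qed.

Lemma kev_invn k x y : kev (kinvn k) x y = (enorm (y - x))^-1 ^+ k.
Proof. by elim: k => [|k IH] /=; rewrite ?expr0// exprS IH. Qed.

Lemma is_derive_inv_dist x y i : y != x ->
  is_derive y (delta_mx 0 i) (fun y => (enorm (y - x))^-1)
    (- (y 0 i - x 0 i) * (enorm (y - x))^-1 ^+ 3).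
Proof.
move=> yx; apply: is_derive_line.
pose z := y - x.
have zE t j : (t *: delta_mx 0 i + y - x) 0 j = t * (i == j)%:R + z 0 j.
  by rewrite !mxE eqxx /= (eq_sym j) addrA.
have z0 : enorm z != 0 by rewrite enorm_eq0 subr_eq0.
pose S (t : R) := t ^+ 2 + 2 * z 0 i * t + enorm z ^+ 2.
have SE t : enorm (t *: delta_mx 0 i + y - x) = Num.sqrt (S t).
  congr Num.sqrt; rewrite /S sqr_enorm.
  under eq_bigr do rewrite zE sqrrD.
  rewrite !big_split/=; congr (_ + _ + _).
    rewrite (bigD1 i)//= eqxx mulr1 big1 ?addr0// => j ji.
    by rewrite eq_sym (negPf ji) mulr0 expr0n.
  rewrite (bigD1 i)//= eqxx mulr1 big1 ?addr0.
    by rewrite mulr2n; ring.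
  by move=> j ji; rewrite eq_sym (negPf ji) mulr0 mul0r ?mul0rn ?addr0.
under eq_fun do rewrite SE.
have S0 : S 0 = enorm z ^+ 2 by rewrite /S; ring.
have S0gt : 0 < S 0 by rewrite S0 exprn_gt0// lt_def z0 enorm_ge0.
have sS : Num.sqrt (S 0) = enorm z by rewrite S0 sqrtr_sqr ger0_norm ?enorm_ge0.
have dS : is_derive (0 : R) 1 S (2 * z 0 i).
  have -> : S = (fun t : R => t) * (fun t : R => t)
            + (2 * z 0 i) \*: (fun t : R => t) + cst (enorm z ^+ 2).
    by apply/funext => t.
  have dI := is_derive_id (0 : R) (1 : R).
  apply: (is_derive_eq (is_deriveD (is_deriveD (is_deriveM dI dI)
    (is_deriveZ (2 * z 0 i) dI)) (is_derive_cst _ _ _))).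
  by rewrite /GRing.scale/= !mul0r !add0r addr0 mulr1.
have dq : is_derive (S 0) 1 (@Num.sqrt R) (2 * Num.sqrt (S 0))^-1.
  exact: is_derive1_sqrt.
have dqS : is_derive (0 : R) 1 (Num.sqrt \o S) (2 * z 0 i * (2 * Num.sqrt (S 0))^-1).
  by apply: is_derive_eq; rewrite mulrC.
have n0 : (Num.sqrt \o S) 0 != 0 by rewrite /= sS.
apply: (is_derive_eq (is_deriveV n0 dqS)).
rewrite /= sS /GRing.scale/= /z !mxE.
field.
exact: z0.
Qed.
End Kernels.

Arguments KConst {R n} c.
Arguments KY {R n} i.
Arguments KX {R n} i.
Arguments KInv {R n}.
Arguments kz {R n} i.
Arguments kinvn {R n} k.
Arguments KAdd {R n} _ _.
Arguments KMul {R n} _ _.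

(** Only the values for [y] different from [x] matter: on the diagonal [KInv]
    has the conventional value [0^-1]. *)
Definition keq (R : realType) (n : nat) (e1 e2 : kexpr R n) :=
  forall x y, y != x -> kev e1 x y = kev e2 x y.

Notation "e1 =k e2" := (keq e1 e2) (at level 70).

Section FormalCalculus.
Variables (R : realType) (n : nat).
Implicit Types (x y : 'rV[R]_n) (i j : 'I_n) (e u v w l : kexpr R n).

Lemma is_derive_kev e x y i : y != x ->
  is_derive y (delta_mx 0 i) (kev e x) (kev (kpd i e) x y).
Proof.
move=> yx; elim: e => [c|j|j||e1 IH1 e2 IH2|e1 IH1 e2 IH2].
- exact: is_derive_cst.
- apply: is_derive_line.
  have -> : (fun t => kev (KY j) x (t *: delta_mx 0 i + y)) =
      (i == j)%:R *: (fun t : R => t) + cst (y 0 j).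
    apply/funext => t /=; rewrite !mxE eqxx /= (eq_sym j).
    by rewrite [RHS]/(_ * _ + _) mulrC.
  apply: (is_derive_eq (is_deriveD (is_deriveZ (i == j)%:R
    (is_derive_id (0 : R) (1 : R))) (is_derive_cst _ _ _))).
  by rewrite addr0 [_%:A]mulr1.
- exact: is_derive_cst.
- have -> : kev (kpd i KInv) x y =
      - (y 0 i - x 0 i) * (enorm (y - x))^-1 ^+ 3.
    by rewrite /= !mulr1 !exprS expr0 mulr1; ring.
  exact: is_derive_inv_dist.
- exact: is_deriveD.
- apply: (is_derive_eq (is_deriveM IH1 IH2)).
  by rewrite /GRing.scale/=; ring.
Qed.


Lemma keq_trans e2 e1 e3 : e1 =k e2 -> e2 =k e3 -> e1 =k e3.
Proof. by move=> h1 h2 x y yx; rewrite h1// h2. Qed.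

(** The formal derivative computes the actual one, which only depends on the
    values in a neighbourhood. *)
Lemma kpd_eq i e1 e2 : e1 =k e2 -> kpd i e1 =k kpd i e2.
Proof.
move=> e12 x y yx.
have [_ <-] := is_derive_kev e1 i yx; have [_ <-] := is_derive_kev e2 i yx.
apply: near_eq_derive; near=> z; apply: e12.
by near: z; exact: near_neq.
Unshelve. all: by end_near. Qed.

Lemma kev_lap e x y : kev (klap e) x y = \sum_i kev (kpd i (kpd i e)) x y.
Proof. exact: kev_sum. Qed.

Lemma kpdC i j e x y : kev (kpd i (kpd j e)) x y = kev (kpd j (kpd i e)) x y.
Proof.
elim: e => //= [|e1 -> e2 -> //|e1 IH1 e2 IH2]; last by rewrite IH1 IH2; ring.
by rewrite (eq_sym j i); ring.
Qed.

Lemma klap_eq e1 e2 : e1 =k e2 -> klap e1 =k klap e2.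
Proof.
move=> e12 x y yx; rewrite !kev_lap; apply: eq_bigr => i _.
exact/kpd_eq/yx/kpd_eq.
Qed.

Lemma klapD e1 e2 : klap (KAdd e1 e2) =k KAdd (klap e1) (klap e2).
Proof. by move=> x y _; rewrite /= !kev_lap -big_split. Qed.

Lemma klap_pd i e : klap (kpd i e) =k kpd i (klap e).
Proof.
move=> x y yx; rewrite kev_lap /klap kpd_sum kev_sum; apply: eq_bigr => j _.
rewrite [RHS]kpdC; apply: kpd_eq yx => x' y' _; exact: kpdC.
Qed.

(** An expression all of whose partial derivatives vanish behaves as a scalar;
    functions of the parameter alone are of this kind. *)
Definition kscalar l := forall i, kpd i l =k KConst 0.

Lemma kscalarC c : kscalar (KConst c).
Proof. by []. Qed.

Lemma klapZ l e : kscalar l -> klap (KMul l e) =k KMul l (klap e).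
Proof.
move=> lc x y yx; rewrite /= !kev_lap big_distrr/=; apply: eq_bigr => i _.
by rewrite (lc i x y yx) (kpd_eq i (lc i) yx) /=; ring.
Qed.

Definition klapn k e := iter k (@klap R n) e.

Lemma klapn_eq k e1 e2 : e1 =k e2 -> klapn k e1 =k klapn k e2.
Proof. by move=> e12; elim: k => //= k; apply: klap_eq. Qed.

Lemma klapnD k e1 e2 : klapn k (KAdd e1 e2) =k KAdd (klapn k e1) (klapn k e2).
Proof.
by elim: k => //= k IH; apply: keq_trans (klap_eq IH) (klapD _ _).
Qed.

Lemma klapnZ k l e : kscalar l -> klapn k (KMul l e) =k KMul l (klapn k e).
Proof.
by move=> lc; elim: k => //= k IH; apply: keq_trans (klap_eq IH) (klapZ _ _).
Qed.

Lemma klapn0 k : klapn k (KConst 0) =k KConst 0.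
Proof.
elim: k => //= k IH; apply: keq_trans (klap_eq IH) _ => x y _.
by rewrite kev_lap big1.
Qed.

Lemma klapn_eq0 k e : e =k KConst 0 -> klapn k e =k KConst 0.
Proof. by move=> e0; apply: keq_trans (klapn_eq k e0) (klapn0 k). Qed.

Lemma klapn_le k m e : (k <= m)%N -> klapn k e =k KConst 0 ->
  klapn m e =k KConst 0.
Proof. by move=> /subnK<- e0; rewrite /klapn iterD; exact: klapn_eq0. Qed.

Lemma klapn_sum k F x y : y != x ->
  kev (klapn k (ksum F)) x y = \sum_i kev (klapn k (F i)) x y.
Proof.
move=> yx; rewrite /ksum; elim: (index_enum _) => [|i s IH].
  by rewrite !big_nil klapn0.
by rewrite !big_cons klapnD//= IH.
Qed.

(** The [i]-th coordinate of [y] up to a translation, which covers both [KY i]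
    and [kz i]. *)
Definition kcoord i l := forall j, kpd j l =k KConst (j == i)%:R.

Lemma kcoordY i : kcoord i (KY i).
Proof. by []. Qed.

Lemma kcoordz i : kcoord i (kz i).
Proof. by move=> j x y _ /=; ring. Qed.

(** By induction from the case [k = 1], which holds because the second
    derivatives of [l] vanish. *)
Lemma klapn_coord k i l e : kcoord i l ->
  klapn k (KMul l e) =k
  KAdd (KMul l (klapn k e)) (kscale (2 * k%:R) (kpd i (klapn k.-1 e))).
Proof.
move=> li.
have step u : klap (KMul l u) =k KAdd (KMul l (klap u)) (kscale 2 (kpd i u)).
  move=> x y yx; rewrite /= !kev_lap big_distrr/=.
  have -> : 2 * kev (kpd i u) x y = \sum_j 2 * (j == i)%:R * kev (kpd j u) x y.
    rewrite (bigD1 i)//= eqxx mulr1 big1 ?addr0// => j /negPf->.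
    by rewrite mulr0 mul0r.
  rewrite -big_split/=; apply: eq_bigr => j _.
  by rewrite (li j x y yx) (kpd_eq j (li j) yx) /=; ring.
elim: k => [|k IH] x y yx; first by rewrite /= mulr0 mul0r addr0.
rewrite [LHS](klap_eq IH yx) klapD//= step//=.
rewrite (klapZ _ (kscalarC _) yx)/=.
case: k IH => [|k] _ /=; first by rewrite !mulr0 !mul0r addr0 mulr1.
rewrite klap_pd//= /klapn /= (mulrSr _ k.+1).
ring.
Qed.

End FormalCalculus.

(** * Taylor polynomials of kernels *)

Section Jets.
Variables (R : realType) (n : nat).
Implicit Types (x y : 'rV[R]_n) (i j : 'I_n) (e u v w l : kexpr R n).

Fixpoint kpoly e : bool :=
  match e with
  | KConst _ | KY _ => true
  | KX _ | KInv => false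
  | KAdd e1 e2 | KMul e1 e2 => kpoly e1 && kpoly e2
  end.

Lemma kpoly_sum F : (forall i, kpoly (F i)) -> kpoly (ksum F).
Proof.
by move=> Fp; rewrite /ksum; elim/big_rec : _ => //= i e _ ->; rewrite Fp.
Qed.

Variables (x0 y0 : 'rV[R]_n).
Hypothesis y0x0 : y0 != x0.

(** The homogeneous part of degree [k] of the Taylor expansion at [y0], built
    from Euler's identity [k T_k = sum_i (y_i - y0_i) d_i T_k]; in this form it
    visibly commutes with derivation ([kpd_taylor_part]). *)
Fixpoint taylor_part k e : kexpr R n :=
  if k is k'.+1 then
    kscale k%:R^-1
      (ksum (fun i => KMul (KAdd (KY i) (KConst (- y0 0 i)))
                           (taylor_part k' (kpd i e))))
  else KConst (kev e x0 y0).

Lemma kpoly_taylor_part k e : kpoly (taylor_part k e).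
Proof.
by elim: k e => //= k IH e; apply: kpoly_sum => i /=; exact: IH.
Qed.

Lemma kev_taylor_partS k e x y : kev (taylor_part k.+1 e) x y =
  k.+1%:R^-1 * \sum_i (y 0 i - y0 0 i) * kev (taylor_part k (kpd i e)) x y.
Proof. by rewrite [LHS]/= kev_sum. Qed.

Lemma kev_pd_taylor_partS k j e x y : kev (kpd j (taylor_part k.+1 e)) x y =
  k.+1%:R^-1 * \sum_i ((j == i)%:R * kev (taylor_part k (kpd i e)) x y
     + (y 0 i - y0 0 i) * kev (kpd j (taylor_part k (kpd i e))) x y).
Proof.
rewrite [LHS]/= kpd_sum mul0r add0r !kev_sum; congr (_ * _).
by apply: eq_bigr => i _ /=; rewrite addr0.
Qed.

Arguments taylor_part : simpl never.

Lemma taylor_part_eq k e1 e2 x y : e1 =k e2 ->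
  kev (taylor_part k e1) x y = kev (taylor_part k e2) x y.
Proof.
elim: k e1 e2 => [|k IH] e1 e2 e12; first exact: e12.
rewrite !kev_taylor_partS; congr (_ * _); apply: eq_bigr => i _.
by rewrite (IH _ _ (kpd_eq i e12)).
Qed.

Lemma kpd_taylor_part k j e x y :
  kev (kpd j (taylor_part k.+1 e)) x y = kev (taylor_part k (kpd j e)) x y.
Proof.
have sumj (F : 'I_n -> R) : \sum_i (j == i)%:R * F i = F j.
  rewrite (bigD1 j)//= eqxx mul1r big1 ?addr0// => i /negPf ij.
  by rewrite eq_sym ij mul0r.
elim: k e => [|k IH] e; rewrite kev_pd_taylor_partS big_split/= sumj.
  rewrite invr1 mul1r big1 ?addr0// => i _; exact: mulr0.
set G := kev (taylor_part k.+1 (kpd j e)) x y.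
have sumE : \sum_i (y 0 i - y0 0 i) * kev (kpd j (taylor_part k.+1 (kpd i e))) x y
    = k.+1%:R * G.
  rewrite /G kev_taylor_partS mulrA mulfV ?pnatr_eq0// mul1r.
  apply: eq_bigr => i _; rewrite IH; congr (_ * _).
  by apply: taylor_part_eq => x' y' _; exact: kpdC.
rewrite sumE.
have -> : G + k.+1%:R * G = k.+2%:R * G by rewrite [k.+2%:R]mulrS mulrDl mul1r.
by rewrite mulrA mulVf ?pnatr_eq0// mul1r.
Qed.

Definition taylor K e :=
  \big[KAdd/KConst 0]_(k < K.+1) taylor_part k e.

Lemma kev_taylor K e x y :
  kev (taylor K e) x y = \sum_(k < K.+1) kev (taylor_part k e) x y.
Proof. exact: (big_morph (fun e => kev e x y)). Qed.

Lemma kpoly_taylor K e : kpoly (taylor K e).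
Proof.
rewrite /taylor; elim/big_rec : _ => //= i u _ ->.
by rewrite kpoly_taylor_part.
Qed.

Lemma kpd_taylorS K j e : kpd j (taylor K.+1 e) =k taylor K (kpd j e).
Proof.
move=> x y _.
have -> : kpd j (taylor K.+1 e) =
    \big[KAdd/KConst 0]_(k < K.+2) kpd j (taylor_part k e).
  exact: (big_morph (kpd j)).
transitivity (\sum_(k < K.+2) kev (kpd j (taylor_part k e)) x y).
  exact: (big_morph (fun e => kev e x y)).
rewrite kev_taylor big_ord_recl /= add0r.
by apply: eq_bigr => k _; exact: kpd_taylor_part.
Qed.

Lemma taylor_eq K e1 e2 : e1 =k e2 -> taylor K e1 =k taylor K e2.
Proof.
move=> e12 x y _; rewrite !kev_taylor; apply: eq_bigr => k _.
exact: taylor_part_eq.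
Qed.

Lemma taylor_sum K F x y :
  kev (taylor K (ksum F)) x y = \sum_i kev (taylor K (F i)) x y.
Proof.
under eq_bigr do rewrite kev_taylor.
rewrite exchange_big kev_taylor; apply: eq_bigr => k _ /=.
elim: (k : nat) F => [|k' IH] F; first by rewrite /= kev_sum.
rewrite kev_taylor_partS; under [RHS]eq_bigr do rewrite kev_taylor_partS.
rewrite -big_distrr/=; congr (_ * _).
rewrite exchange_big /=; apply: eq_bigr => j _ /=.
by rewrite kpd_sum IH big_distrr.
Qed.

Lemma taylor0 K : taylor K (KConst 0) =k KConst 0.
Proof.
move=> x y _; rewrite kev_taylor big1// => k _.
elim: (k : nat) => // k' IH.
by rewrite kev_taylor_partS big1 ?mulr0// => i _; rewrite /= IH mulr0.
Qed.

(** The Laplacian commutes with the expansion, lowering its degree by two. *)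
Lemma klap_taylor K e : klap e =k KConst 0 -> klap (taylor K.+2 e) =k KConst 0.
Proof.
move=> e0; apply: keq_trans (taylor0 K).
apply: keq_trans (taylor_eq K e0) => x y yx.
rewrite /klap taylor_sum kev_sum; apply: eq_bigr => i _.
rewrite (kpd_eq i (kpd_taylorS _ _ _) yx); exact: kpd_taylorS.
Qed.

(** Vanishing of order greater than [K] at [y0]. *)
Fixpoint jet0 K e : Prop :=
  kev e x0 y0 = 0 /\ if K is K'.+1 then forall i, jet0 K' (kpd i e) else True.

Lemma jet0_ev K e : jet0 K e -> kev e x0 y0 = 0.
Proof. by case: K => [|K] []. Qed.

Lemma jet0_eq K e1 e2 : e1 =k e2 -> jet0 K e1 -> jet0 K e2.
Proof.
elim: K e1 e2 => [|K IH] e1 e2 e12 [e10 d0]; (split; first by rewrite -e12) => //.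
by move=> i; apply: IH (d0 i); exact: kpd_eq.
Qed.

Lemma jet0_le K e : jet0 K.+1 e -> jet0 K e.
Proof. by elim: K e => [|K IH] e /= [e0 d0]; split=> // i; exact: IH. Qed.

Lemma jet0D K e1 e2 : jet0 K e1 -> jet0 K e2 -> jet0 K (KAdd e1 e2).
Proof.
elim: K e1 e2 => [|K IH] e1 e2 [e10 d1] [e20 d2].
  by split; first by rewrite /= e10 e20 addr0.
split; first by rewrite /= e10 e20 addr0.
by move=> i; apply: IH; [exact: d1|exact: d2].
Qed.

Lemma jet0M K l e : jet0 K e -> jet0 K (KMul l e).
Proof.
elim: K l e => [|K IH] l e e0.
  by split=> //=; case: e0 => -> _; rewrite mulr0.
split=> [/=|i /=]; first by rewrite (jet0_ev e0) mulr0.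
apply: jet0D; apply: IH; first exact: jet0_le.
by case: e0 => _; apply.
Qed.

Lemma jet0_sum K F : (forall i, jet0 K (F i)) -> jet0 K (ksum F).
Proof.
move=> F0; rewrite /ksum; elim/big_rec : _ => [|i e _]; last exact: jet0D.
by elim: K {F0} => [|K IH].
Qed.

Lemma jet0_klap K e : jet0 K.+2 e -> jet0 K (klap e).
Proof. by move=> e0; apply: jet0_sum => i; case: e0 => _ /(_ i)[_ /(_ i)]. Qed.

Lemma jet0_klapn k e : jet0 k.*2 e -> kev (klapn k e) x0 y0 = 0.
Proof.
elim: k e => [|k IH] e; first exact: jet0_ev.
by move=> /jet0_klap /IH; rewrite /klapn iterSr.
Qed.

Lemma jet0_taylor K e : jet0 K (KAdd e (kscale (-1) (taylor K e))).
Proof.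
have ev0 k u : kev (KAdd u (kscale (-1) (taylor k u))) x0 y0 = 0.
  rewrite /= kev_taylor big_ord_recl/= big1 ?addr0 ?mulN1r ?subrr// => i _.
  by rewrite kev_sum big1 ?mulr0// => j _; rewrite /= subrr mul0r.
elim: K e => [|K IH] e; split => // i.
apply: jet0_eq (IH (kpd i e)) => x y yx /=.
by rewrite kpd_taylorS//; ring.
Qed.

End Jets.

Section Transfer.
Variables (R : realType) (n : nat).
Implicit Types (x y : 'rV[R]_n) (i j : 'I_n) (e u v w l : kexpr R n).

(** At each point a harmonic function has the same jet, to any finite order, as
    a harmonic polynomial, and a differential operator only depends on such a
    jet. *)
Lemma harmonic_transfer k a :
  (forall h, kpoly h -> klap h =k KConst 0 -> klapn k (KMul a h) =k KConst 0) ->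
  forall u, klap u =k KConst 0 -> klapn k (KMul a u) =k KConst 0.
Proof.
move=> ha u u0 x y yx.
pose T := taylor x y k.*2.+2 u.
have T0 : klapn k (KMul a T) =k KConst 0.
  by apply: ha; [exact: kpoly_taylor|exact: klap_taylor].
have uE : KMul a u =k KAdd (KMul a (KAdd u (kscale (-1) T))) (KMul a T).
  by move=> ? ? _ /=; ring.
rewrite (klapn_eq k uE yx) klapnD//= T0//= addr0.
apply: jet0_klapn; apply: jet0M.
by do 2 apply: jet0_le; exact: jet0_taylor.
Qed.

End Transfer.

(** * Homogeneity and the Euler operator *)

Section Homogeneity.
Variables (R : realType) (n : nat).
Implicit Types (x y : 'rV[R]_n) (i j : 'I_n) (e u v w l : kexpr R n).
Implicit Types (c d : R).

Definition keuler e := ksum (fun i => KMul (kz i) (kpd i e)).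

Lemma kev_euler e x y :
  kev (keuler e) x y = \sum_i (y 0 i - x 0 i) * kev (kpd i e) x y.
Proof. by rewrite kev_sum; apply: eq_bigr => i _ /=; rewrite mulN1r. Qed.

Lemma keuler_eq e1 e2 : e1 =k e2 -> keuler e1 =k keuler e2.
Proof.
move=> e12 x y yx; rewrite !kev_euler; apply: eq_bigr => i _.
by rewrite (kpd_eq i e12).
Qed.

Lemma keulerD e1 e2 : keuler (KAdd e1 e2) =k KAdd (keuler e1) (keuler e2).
Proof.
move=> x y _; rewrite /= !kev_euler -big_split; apply: eq_bigr => i _ /=; ring.
Qed.

Lemma keulerM e1 e2 : keuler (KMul e1 e2) =k
  KAdd (KMul (keuler e1) e2) (KMul e1 (keuler e2)).
Proof.
move=> x y _; rewrite /= !kev_euler big_distrl big_distrr -big_split.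
by apply: eq_bigr => i _ /=; ring.
Qed.

Lemma keuler_scalar l : kscalar l -> keuler l =k KConst 0.
Proof.
by move=> lc x y yx; rewrite kev_euler big1// => i _; rewrite lc//= mulr0.
Qed.

Definition khom c e := keuler e =k kscale c e.

Lemma khom_eq c e1 e2 : e1 =k e2 -> khom c e1 -> khom c e2.
Proof.
move=> e12 h x y yx.
by rewrite -(keuler_eq e12 yx) (h x y yx) /= (e12 x y yx).
Qed.

Lemma khomM c d e1 e2 : khom c e1 -> khom d e2 -> khom (c + d) (KMul e1 e2).
Proof.
move=> h1 h2 x y yx.
by rewrite (keulerM _ _ yx) /= (h1 x y yx) (h2 x y yx) /=; ring.
Qed.

Lemma khom_scalar l : kscalar l -> khom 0 l.
Proof. by move=> lc x y yx; rewrite (keuler_scalar lc yx) /= mul0r. Qed.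

Lemma khomz i : khom 1 (kz i).
Proof.
move=> x y yx; rewrite kev_euler (bigD1 i)//= eqxx big1; last first.
  by move=> j /negPf ji; rewrite ji /=; ring.
by rewrite -[true%:R]/(1 : R); ring.
Qed.

Lemma khom_pd c i e : khom c e -> khom (c - 1) (kpd i e).
Proof.
move=> h x y yx.
have := kpd_eq i h yx; rewrite /= mul0r add0r mulrBl => <-.
rewrite /keuler kpd_sum !kev_sum -[LHS](addrK (1 * kev (kpd i e) x y)).
congr (_ - _).
have -> : 1 * kev (kpd i e) x y = \sum_j (i == j)%:R * kev (kpd j e) x y.
  rewrite (bigD1 i)//= eqxx /= big1 ?addr0// => j /negPf ji.
  by rewrite eq_sym ji mul0r.
rewrite -big_split; apply: eq_bigr => j _ /=.
by rewrite kpdC; ring.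
Qed.

Lemma sum_sqrz x y : \sum_i (y 0 i - x 0 i) ^+ 2 = enorm (y - x) ^+ 2.
Proof. by rewrite sqr_enorm; apply: eq_bigr => i _; rewrite !mxE. Qed.

Lemma khom_inv : khom (-1) KInv.
Proof.
move=> x y yx; have z0 : enorm (y - x) != 0 by rewrite enorm_eq0 subr_eq0.
rewrite kev_euler /=.
transitivity (- (\sum_i (y 0 i - x 0 i) ^+ 2) * (enorm (y - x))^-1 ^+ 3).
  rewrite -sumrN big_distrl/=; apply: eq_bigr => i _.
  by rewrite !exprS expr0; ring.
by rewrite sum_sqrz; field.
Qed.

Lemma khom_invn k : khom (- k%:R) (kinvn k).
Proof.
elim: k => [|k IH] /=; first by rewrite oppr0; exact: khom_scalar.
by rewrite mulrS opprD; exact: khomM khom_inv IH.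
Qed.

(** Sums of [k] homogeneous terms, of degrees [m - c] with [m] a positive
    integer; the number of terms is recorded for the induction in
    [graded_eigen0]. *)
Inductive kgraded c : nat -> kexpr R n -> Prop :=
| kgraded0 e : e =k KConst 0 -> kgraded c 0 e
| kgradedS k (m : nat) v e' e : (0 < m)%N -> khom (m%:R - c) v ->
    kgraded c k e' -> e =k KAdd v e' -> kgraded c k.+1 e.

Lemma kgraded_map c d (F : kexpr R n -> kexpr R n) :
  (forall e1 e2, e1 =k e2 -> F e1 =k F e2) ->
  F (KConst 0) =k KConst 0 ->
  (forall e1 e2, F (KAdd e1 e2) =k KAdd (F e1) (F e2)) ->
  (forall m v, (0 < m)%N -> khom (m%:R - c) v ->
    exists2 m', (0 < m')%N & khom (m'%:R - d) (F v)) ->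
  forall k e, kgraded c k e -> kgraded d k (F e).
Proof.
move=> Feq F0 FD Fhom k e; elim=> {k e} [e e0|k m v e' e m0 hv _ IH eE].
  by apply: kgraded0; exact: keq_trans (Feq _ _ e0) F0.
have [m' m'0 hv'] := Fhom _ _ m0 hv.
exact: kgradedS m'0 hv' IH (keq_trans (Feq _ _ eE) (FD _ _)).
Qed.

Lemma kgraded_eq c k e1 e2 : e1 =k e2 -> kgraded c k e1 -> kgraded c k e2.
Proof.
move=> e12 g; case: g e12 => [e e0|k' m v e' e m0 hv g eE] e12.
  by apply: kgraded0 => x y yx; rewrite -e12// e0.
by apply: kgradedS m0 hv g _ => x y yx; rewrite -e12// eE.
Qed.

Definition graded c e := exists k, kgraded c k e.

Lemma graded_eq c e1 e2 : e1 =k e2 -> graded c e1 -> graded c e2.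
Proof. by move=> e12 [k g]; exists k; exact: kgraded_eq g. Qed.

Lemma gradedD c e1 e2 : graded c e1 -> graded c e2 -> graded c (KAdd e1 e2).
Proof.
move=> [k1 g1] [k2 g2]; exists (k1 + k2)%N.
elim: g1 => {k1 e1} [e1 e10|k m v e' e m0 hv _ IH eE].
  by apply: kgraded_eq g2 => x y yx /=; rewrite e10//= add0r.
by apply: kgradedS m0 hv IH _ => x y yx /=; rewrite eE//= addrA.
Qed.

Lemma gradedM_hom c d u e : khom d u -> graded c e -> graded (c - d) (KMul u e).
Proof.
move=> hu [k g]; exists k; move: k e g; apply: (kgraded_map (F := KMul u)).
- by move=> e1 e2 e12 x y yx /=; rewrite e12.
- by move=> x y _ /=; rewrite mulr0.
- by move=> e1 e2 x y _ /=; rewrite mulrDr.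
- move=> m v m0 hv; exists m => //.
  by rewrite opprB addrCA; exact: khomM.
Qed.

Lemma gradedZ c l e : kscalar l -> graded c e -> graded c (KMul l e).
Proof. by move=> /khom_scalar/gradedM_hom + /[dup] => h /h; rewrite subr0. Qed.

Lemma graded0 c : graded c (KConst 0).
Proof. by exists 0; exact: kgraded0. Qed.

Lemma gradedM c e1 e2 : graded 0 e1 -> graded c e2 -> graded c (KMul e1 e2).
Proof.
move=> [k1 g1] g2; elim: g1 => {k1 e1} [e1 e10|k m v e' e m0 hv _ IH eE].
  by apply: graded_eq (graded0 c) => x y yx /=; rewrite e10//= mul0r.
have gv : graded c (KMul v e2).
  case: g2 => [k2 g2]; exists k2; move: k2 e2 g2 {IH}.
  apply: (kgraded_map (F := KMul v)).
  - by move=> e1 e2 e12 x y yx /=; rewrite e12.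
  - by move=> x y _ /=; rewrite mulr0.
  - by move=> e1 e2 x y _ /=; rewrite mulrDr.
  - move=> p u p0 hu; exists (m + p)%N; first by rewrite addn_gt0 m0.
    rewrite natrD -addrA; apply: khomM hu.
    by rewrite subr0 in hv.
by apply: graded_eq (gradedD gv IH) => x y yx /=; rewrite eE//= mulrDl.
Qed.

Lemma graded_pd c i e : graded c e -> graded (c + 1) (kpd i e).
Proof.
move=> [k g]; exists k; move: k e g; apply: (kgraded_map (F := kpd i)) => //.
- exact: kpd_eq.
- move=> m v m0 hv; exists m => //.
  by rewrite opprD addrA; exact: khom_pd.
Qed.

Lemma graded_klap c e : graded c e -> graded (c + 2) (klap e).
Proof.
move=> g; rewrite /klap /ksum; elim/big_rec : _ => [|i u _ gu].
  exact: graded0.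
apply: gradedD gu; have := graded_pd i (graded_pd i g).
by rewrite -addrA.
Qed.

Lemma graded_klapn c k e : graded c e -> graded (c + 2 * k%:R) (klapn k e).
Proof.
move=> g; elim: k => [|k IH]; first by rewrite mulr0 addr0.
have -> : c + 2 * k.+1%:R = c + 2 * k%:R + 2.
  by rewrite [k.+1%:R]mulrSr; ring.
exact: graded_klap.
Qed.

(** On a sum of terms of degrees [m - c] the Euler operator cannot have the
    eigenvalue [- c]: subtracting [m - c] removes one term of degree [m - c]
    but multiplies the sum by [- m], which is not zero. *)
Lemma graded_eigen0 c e : graded c e -> khom (- c) e -> e =k KConst 0.
Proof.
move=> [k]; elim: k e => [|k IH] e g he.
  by inversion g.
inversion g as [|k' m v e' e1 m0 hv ge' eE]; subst.
pose A u := KAdd (keuler u) (kscale (c - m%:R) u).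
have Ae : kgraded c k (A e').
  move: k e' ge' {IH g eE}; apply: (kgraded_map (F := A)).
  - by move=> e1 e2 e12 x y yx /=; rewrite (keuler_eq e12 yx) e12.
  - by move=> x y yx /=; rewrite (keuler_scalar (kscalarC _) yx) /= mulr0 addr0.
  - by move=> e1 e2 x y yx /=; rewrite (keulerD _ _ yx) /=; ring.
  - move=> p u p0 hu; exists p => //.
    apply: (@khom_eq _ (kscale (p%:R - m%:R) u)).
      by move=> x y yx /=; rewrite (hu x y yx) /=; ring.
    by rewrite -[_ - c]add0r; apply: khomM hu; exact: khom_scalar.
have AE : A e' =k kscale (- m%:R) e.
  move=> x y yx; have := keuler_eq eE yx; have := he x y yx.
  have := hv x y yx; rewrite (keulerD _ _ yx) /= eE//= => hv1 he1 he2.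
  have -> : kev (keuler e') x y =
     kev (keuler e) x y - kev (keuler v) x y by rewrite he2; ring.
  by rewrite he1 hv1; ring.
have m0' : m%:R != 0 :> R by rewrite pnatr_eq0 -lt0n.
have /IH /(_ _) me0 : kgraded c k (kscale (- m%:R) e) by exact: kgraded_eq Ae.
move=> x y yx; have := me0 _ x y yx.
rewrite /= => h; apply: (mulfI (x := - m%:R)); first by rewrite oppr_eq0.
rewrite mulr0; apply: h; rewrite -[- c]add0r; apply: khomM he.
exact: khom_scalar.
Qed.

End Homogeneity.

(** * Kernels annihilated by a power of the Laplacian *)

Section KernelPolyharmonic.
Variables (R : realType) (n : nat).
Implicit Types (x y : 'rV[R]_n) (i j : 'I_n) (a e u v w l : kexpr R n).
Local Notation kinv := (@kinvn R n).

(** For a polynomial [a], this makes the constant [a(x)] a kernel in turn. *)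
Fixpoint kdiag e : kexpr R n :=
  match e with
  | KY i => KX i
  | KAdd e1 e2 => KAdd (kdiag e1) (kdiag e2)
  | KMul e1 e2 => KMul (kdiag e1) (kdiag e2)
  | _ => e
  end.

Definition kdiff e := KAdd e (kscale (-1) (kdiag e)).

Lemma kev_diag a x y : kpoly a -> kev (kdiag a) x y = kev a x x.
Proof. by elim: a => //= e1 IH1 e2 IH2 /andP[/IH1-> /IH2->]. Qed.

Lemma kscalarD e1 e2 : kscalar e1 -> kscalar e2 -> kscalar (KAdd e1 e2).
Proof. by move=> c1 c2 i x y yx /=; rewrite c1// c2//= addr0. Qed.

Lemma kscalarM e1 e2 : kscalar e1 -> kscalar e2 -> kscalar (KMul e1 e2).
Proof. by move=> c1 c2 i x y yx /=; rewrite c1// c2//= mul0r mulr0 addr0. Qed.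

Lemma kscalar_diag a : kpoly a -> kscalar (kdiag a).
Proof.
elim: a => //= [e1 IH1 e2 IH2|e1 IH1 e2 IH2] /andP[/IH1 c1 /IH2 c2].
  exact: kscalarD.
exact: kscalarM.
Qed.

(** Products are handled by
    [p q - p0 q0 = (p - p0) (q - q0) + p0 (q - q0) + q0 (p - p0)]. *)
Lemma graded_diff a : kpoly a -> graded 0 (kdiff a).
Proof.
elim: a => //= [c _|i _|e1 IH1 e2 IH2|e1 IH1 e2 IH2].
- by apply: graded_eq (graded0 _ _) => x y _ /=; ring.
- exists 1; apply: (@kgradedS _ _ _ _ 1 (kz i) (KConst 0)) => //.
  + by rewrite subr0; exact: khomz.
  + exact: kgraded0.
  + by move=> x y _ /=; ring.
- move=> /andP[/IH1 g1 /IH2 g2].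
  by apply: graded_eq (gradedD g1 g2) => x y _ /=; ring.
- move=> /andP[p1 p2]; have g1 := IH1 p1; have g2 := IH2 p2.
  have g := gradedD (gradedM g1 g2) (gradedD (gradedZ (kscalar_diag p1) g2)
    (gradedZ (kscalar_diag p2) g1)).
  by apply: graded_eq g => x y _ /=; ring.
Qed.

Lemma kpd_invn i k : kpd i (kinv k) =k
  kscale (- k%:R) (KMul (kz i) (kinv k.+2)).
Proof.
elim: k => [|k IH] x y yx; first by rewrite /= oppr0 mul0r.
rewrite [LHS]/= IH// /= mulrS; ring.
Qed.

Lemma kevD e1 e2 x y : kev (KAdd e1 e2) x y = kev e1 x y + kev e2 x y.
Proof. by []. Qed.

Lemma kevM e1 e2 x y : kev (KMul e1 e2) x y = kev e1 x y * kev e2 x y.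
Proof. by []. Qed.

Lemma kev_pd_scale c i e x y :
  kev (kpd i (kscale c e)) x y = c * kev (kpd i e) x y.
Proof. by rewrite /= mul0r add0r. Qed.

Lemma kev_pd_z i j e x y : kev (kpd j (KMul (kz i) e)) x y =
  (j == i)%:R * kev e x y + (y 0 i - x 0 i) * kev (kpd j e) x y.
Proof. by rewrite /=; ring. Qed.

Lemma klap_invn k : klap (kinv k) =k
  kscale (k%:R * (k.+2%:R - n%:R)) (kinv k.+2).
Proof.
move=> x y yx.
have z0 : enorm (y - x) != 0 by rewrite enorm_eq0 subr_eq0.
rewrite kev_lap.
transitivity (\sum_i ((- k%:R) * (enorm (y - x))^-1 ^+ k.+2
   + k%:R * k.+2%:R * (enorm (y - x))^-1 ^+ k.+4 * (y 0 i - x 0 i) ^+ 2)).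
  apply: eq_bigr => i _; rewrite (kpd_eq i (kpd_invn i k) yx).
  rewrite kev_pd_scale kev_pd_z eqxx kpd_invn// [LHS]/= !kev_invn.
  by rewrite -[true%:R]/(1 : R) !exprS; ring.
rewrite big_split/= sumr_const card_ord -big_distrr/= sum_sqrz [RHS]/= kev_invn.
rewrite -[(_ * _) *+ n]mulr_natr !exprS.
by field.
Qed.

Lemma klap_coord i l e : kcoord i l ->
  klap (KMul l e) =k KAdd (KMul l (klap e)) (kscale 2 (kpd i e)).
Proof.
by move=> li x y yx; have := klapn_coord 1 e li yx; rewrite /= mulr1.
Qed.

(** For [n <> 2] the functions [z_i / |z|^n] and [|z|^2 / |z|^n] of [z = y - x]
    are, up to constant factors, the first derivatives of the Newton kernel and
    the Newton kernel itself. *)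
Lemma klap_newton_pd i : klap (KMul (kz i) (kinv n)) =k KConst 0.
Proof.
move=> x y yx; rewrite (klap_coord _ (@kcoordz _ _ i) yx).
rewrite [LHS]/= klap_invn// kpd_invn//= -natr1 -natr1.
ring.
Qed.

Lemma klap_newton :
  klap (ksum (fun i => KMul (kz i) (KMul (kz i) (kinv n)))) =k KConst 0.
Proof.
move=> x y yx; have := klapn_sum 1 (fun i => KMul (kz i) (KMul (kz i) (kinv n))) yx.
rewrite /klapn /= => ->.
have z0 : enorm (y - x) != 0 by rewrite enorm_eq0 subr_eq0.
transitivity (\sum_i (2 * (enorm (y - x))^-1 ^+ n
  - 2 * n%:R * (enorm (y - x))^-1 ^+ n.+2 * (y 0 i - x 0 i) ^+ 2)).
  apply: eq_bigr => i _; rewrite (klap_coord _ (@kcoordz _ _ i) yx).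
  rewrite [LHS]/= klap_newton_pd// kpd_invn//= eqxx -[true%:R]/(1 : R).
  by rewrite kev_invn !exprS; ring.
rewrite big_split/= sumr_const card_ord sumrN -big_distrr/= sum_sqrz.
rewrite -[(_ * _) *+ n]mulr_natr !exprS.
by field.
Qed.

(** With [v = Delta^N u], the two families of harmonic functions above give
    [(E + n + 2 N) v = 0], whereas [v] is a sum of terms of degrees
    [m - (n + 2 N)] with [m > 0]. *)
Theorem kernel_polyharmonic N a : kpoly a ->
  (forall h, kpoly h -> klap h =k KConst 0 ->
    klapn N.+1 (KMul a h) =k KConst 0) ->
  klapn N (KMul (kdiff a) (kinv n)) =k KConst 0.
Proof.
move=> pa ha.
have hd u : klap u =k KConst 0 -> klapn N.+1 (KMul (kdiff a) u) =k KConst 0.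
  move=> u0 x y yx; have u1 : klapn N.+1 u =k KConst 0.
    by apply: (@klapn_le _ _ 1).
  have sd : kscalar (kscale (-1) (kdiag a)).
    by apply: kscalarM (kscalarC _) (kscalar_diag pa).
  rewrite (klapn_eq _ (_ : _ =k KAdd (KMul a u) (KMul (kscale (-1) (kdiag a)) u)))//.
    rewrite klapnD// kevD (harmonic_transfer ha u0 yx).
    by rewrite (klapnZ _ _ sd yx) kevM u1// mulr0 addr0.
  by move=> ? ? _ /=; ring.
set u := KMul (kdiff a) (kinv n).
set v := klapn N u.
have zu0 i : klapn N.+1 (KMul (kz i) u) =k KConst 0.
  apply: keq_trans (hd _ (@klap_newton_pd i)); apply: klapn_eq => x y _ /=; ring.
have hv : khom (- (n%:R + 2 * N%:R)) v.
  move=> x y yx.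
  (* Delta^(N+1) (z_i (z_i u)) reduces to 2 (N+1) d_i Delta^N (z_i u), since the
     other term of the commutator contains Delta^(N+1) (z_i u) *)
  have s0 : \sum_i kev (kpd i (klapn N (KMul (kz i) u))) x y = 0.
    have := hd _ klap_newton x y yx.
    rewrite (klapn_eq _ (_ : _ =k ksum (fun i => KMul (kz i) (KMul (kz i) u))))//.
      rewrite klapn_sum// => h.
      have N0 : 2 * N.+1%:R != 0 :> R by rewrite mulf_neq0// pnatr_eq0.
      apply: (mulfI N0); rewrite mulr0 -[RHS]h mulr_sumr.
      apply: eq_bigr => i _.
      rewrite (klapn_coord _ _ (@kcoordz _ _ i) yx).
      by rewrite kevD !kevM zu0// mulr0 add0r.
    move=> x' y' _ /=; rewrite !kev_sum big_distrr/=.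
    by apply: eq_bigr => i _ /=; ring.
  have : \sum_i (kev v x y + (y 0 i - x 0 i) * kev (kpd i v) x y
      + 2 * N%:R * kev (kpd i (kpd i (klapn N.-1 u))) x y) = 0.
    rewrite -[RHS]s0; apply: eq_bigr => i _.
    rewrite (kpd_eq i (klapn_coord N u (@kcoordz _ _ i)) yx).
    rewrite /= -/v eqxx -[true%:R]/(1 : R).
    ring.
  rewrite !big_split/= sumr_const card_ord -kev_euler -big_distrr/= -kev_lap.
  have -> : 2 * N%:R * kev (klap (klapn N.-1 u)) x y = 2 * N%:R * kev v x y.
    by rewrite /v; case: (N) => [|M]//; rewrite mulr0 !mul0r.
  rewrite -mulr_natr => h.
  apply/eqP; rewrite -subr_eq0; apply/eqP; rewrite -[RHS]h /=; ring.
apply: graded_eigen0 hv; rewrite /v; apply: graded_klapn.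
rewrite -[n%:R]add0r -[n%:R]opprK.
apply: graded_eq (gradedM_hom (@khom_invn R n n) (graded_diff pa)).
by move=> x y _ /=; ring.
Qed.

(** By [klapn_coord] multiplication by a coordinate raises the polyharmonic
    degree by at most one. *)
Lemma kpoly_degree_bound (p : kexpr R n) : kpoly p -> exists M, forall k (h : kexpr R n),
  klapn k h =k KConst 0 -> klapn (k + M) (KMul p h) =k KConst 0.
Proof.
elim: p => //= [c _|i _|e1 IH1 e2 IH2 /andP[/IH1[M1 h1] /IH2[M2 h2]]|
                e1 IH1 e2 IH2 /andP[/IH1[M1 h1] /IH2[M2 h2]]].
- exists 0%N => k h h0; rewrite addn0 => x y yx.
  by rewrite (klapnZ _ _ (kscalarC _) yx) /= h0//= mulr0.
- exists 1%N => k h h0; rewrite addn1 => x y yx.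
  rewrite (klapn_coord _ _ (@kcoordY _ _ i) yx) kevD !kevM.
  rewrite (kpd_eq i h0 yx) mulr0 addr0.
  by rewrite (@klapn_le _ _ k k.+1 h)// mulr0.
- exists (M1 + M2)%N => k h h0.
  have h1' : klapn (k + (M1 + M2)) (KMul e1 h) =k KConst 0.
    by apply: klapn_le (h1 _ _ h0); rewrite leq_add2l leq_addr.
  have h2' : klapn (k + (M1 + M2)) (KMul e2 h) =k KConst 0.
    by apply: klapn_le (h2 _ _ h0); rewrite leq_add2l leq_addl.
  move=> x y yx.
  rewrite (klapn_eq _ (_ : _ =k KAdd (KMul e1 h) (KMul e2 h)))//.
    by rewrite klapnD//= h1'// h2'//= addr0.
  by move=> ? ? _ /=; ring.
- exists (M2 + M1)%N => k h /h2 /h1; rewrite addnA => h0 x y yx.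
  rewrite -(h0 x y yx); apply: klapn_eq yx => ? ? _ /=; ring.
Qed.

End KernelPolyharmonic.

(** * Estimates uniform in the parameter *)

Section LocallyUniform.
Variables (R : realType) (n : nat) (rad : R).
Implicit Types (x y : 'rV[R]_n) (i j : 'I_n) (e u v w l : kexpr R n).

Lemma kev_bounded e y : rad < enorm y ->
  exists2 M, 0 <= M & forall x, enorm x <= rad -> `|kev e x y| <= M.
Proof.
move=> ry; elim: e => [c|i|i||e1 [M1 M10 h1] e2 [M2 M20 h2]|
                      e1 [M1 M10 h1] e2 [M2 M20 h2]].
- by exists `|c|.
- by exists `|y 0 i|.
- have [r0|r0] := leP 0 rad; last first.
    by exists 0 => // x /le_lt_trans/(_ r0); rewrite ltNge enorm_ge0.
  exists rad => // x; apply: le_trans.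
  rewrite /= -sqrtr_sqr /enorm ler_wsqrtr// (bigD1 i)//= lerDl sumr_ge0// => j _.
  exact: sqr_ge0.
- exists (enorm y - rad)^-1; first by rewrite invr_ge0 subr_ge0 ltW.
  move=> x xr /=; rewrite ger0_norm ?invr_ge0 ?enorm_ge0//.
  rewrite lef_pV2 ?posrE ?subr_gt0//.
    by rewrite (le_trans _ (enormB_ge _ _))// lerB.
  by rewrite enorm_gt0 subr_eq0 (outside_neq xr).
- exists (M1 + M2); first exact: addr_ge0.
  move=> x xr /=; rewrite (le_trans (ler_normD _ _))// lerD ?h1 ?h2//.
- exists (M1 * M2); first exact: mulr_ge0.
  by move=> x xr /=; rewrite normrM ler_pM ?h1 ?h2.
Qed.

(** Continuity in [y], uniform for [x] in the closed ball, is preserved by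
    sums and products since the values at each point are bounded. *)
Lemma kev_equicontinuous e y (eps : R) : rad < enorm y -> 0 < eps ->
  \forall z \near y, forall x, enorm x <= rad -> `|kev e x z - kev e x y| <= eps.
Proof.
move=> ry; elim: e eps => [c|i|i||e1 IH1 e2 IH2|e1 IH1 e2 IH2] eps e0.
- by near=> z => x _ /=; rewrite subrr normr0 ltW.
- have /cvgrPdist_le /(_ eps e0) := @coord_continuous R _ _ ord0 i y.
  by apply: filterS => z + x _ /=; rewrite distrC.
- by near=> z => x _ /=; rewrite subrr normr0 ltW.
- pose d := enorm y - rad.
  have d0 : 0 < d by rewrite subr_gt0.
  (* moving y by at most d / 2 keeps |y - x| >= d / 2, so that 1 / |y - x| varies
     by at most the displacement divided by d^2 / 2 *)
  pose del := Num.min (d / 2) (eps * (d ^+ 2 / 2)).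
  have del0 : 0 < del.
    by rewrite lt_min !divr_gt0//= mulr_gt0// divr_gt0// exprn_gt0.
  apply: filterS (near_enorm_lt y del0) => z zd x xr /=.
  have zd1 : enorm (z - y) <= d / 2.
    by rewrite ltW// (lt_le_trans zd)// ge_min lexx.
  have zd2 : enorm (z - y) <= eps * (d ^+ 2 / 2).
    by rewrite ltW// (lt_le_trans zd)// ge_min lexx orbT.
  have a1 : d <= enorm (y - x) by rewrite (le_trans _ (enormB_ge _ _))// lerB.
  have ab : `|enorm (y - x) - enorm (z - x)| <= enorm (z - y).
    apply: le_trans (enorm_dist_le _ _) _.
    by rewrite -enormN; rewrite (_ : - _ = z - y)//; apply/rowP => k; rewrite !mxE; ring.
  have b1 : d / 2 <= enorm (z - x).
    have : enorm (y - x) - enorm (z - x) <= d / 2.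
      by rewrite (le_trans (ler_norm _))// (le_trans ab).
    by move: a1; lra.
  move: a1 ab b1; move: (enorm (y - x)) (enorm (z - x)) => a b a1 ab b1.
  have a0 : 0 < a by exact: lt_le_trans a1.
  have b0 : 0 < b by apply: lt_le_trans b1; rewrite divr_gt0.
  have -> : b^-1 - a^-1 = (a - b) / (b * a).
    by field; rewrite !gt_eqF.
  rewrite normrM (le_trans (ler_wpM2r _ (le_trans ab zd2)))//.
  rewrite normfV ger0_norm; last by rewrite mulr_ge0// ltW.
  rewrite -[leLHS]mulrA; apply: ler_piMr; first exact: ltW.
  rewrite ler_pdivrMr ?mulr_gt0// mul1r.
  have -> : d ^+ 2 / 2 = d / 2 * d by ring.
  by apply: ler_pM => //; rewrite ltW// divr_gt0.
- have eps2 : 0 < eps / 2 by rewrite divr_gt0.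
  apply: filterS2 (IH1 _ eps2) (IH2 _ eps2) => z h1 h2 x xr /=.
  rewrite opprD addrACA (le_trans (ler_normD _ _))//.
  by rewrite [leRHS]splitr lerD ?h1 ?h2.
- have [M1 M10 b1] := kev_bounded e1 ry; have [M2 M20 b2] := kev_bounded e2 ry.
  pose del := Num.min 1 (eps / (1 + M1 + M2)).
  have M0 : 0 < 1 + M1 + M2 by rewrite -addrA ltr_pwDl// addr_ge0.
  have del0 : 0 < del by rewrite lt_min ltr01 divr_gt0.
  have del1 : del <= 1 by rewrite ge_min lexx.
  have delE : del * (1 + M1 + M2) <= eps.
    by rewrite -ler_pdivlMr// ge_min lexx orbT.
  apply: filterS2 (IH1 _ del0) (IH2 _ del0) => z h1 h2 x xr /=.
  have {}h1 := h1 x xr; have {}h2 := h2 x xr.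
  have {}b1 := b1 x xr; have {}b2 := b2 x xr.
  move: h1 h2 b1 b2.
  move: (kev e1 x z) (kev e2 x z) (kev e1 x y) (kev e2 x y) => a b a0 b0.
  move=> h1 h2 b1 b2; apply: le_trans delE.
  have -> : a * b - a0 * b0 = (a - a0) * (b - b0) + (a0 * (b - b0) + (a - a0) * b0).
    by ring.
  have -> : del * (1 + M1 + M2) = del * 1 + (M1 * del + del * M2) by ring.
  apply: le_trans (ler_normD _ _) _; apply: lerD.
    by rewrite normrM ler_pM// (le_trans h2).
  by apply: le_trans (ler_normD _ _) _; apply: lerD; rewrite normrM ler_pM.
Unshelve. all: by end_near. Qed.

End LocallyUniform.

(** * Integrals of kernels *)

Section KernelIntegral.
Variables (R : realType) (n : nat) (rad : R).
Implicit Types (x y : 'rV[R]_n) (i j : 'I_n) (e u v w l : kexpr R n).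

Lemma continuous_measurable_borelRn (f : 'rV[R]_n -> R) :
  continuous f -> measurable_fun setT (f : borelRn R n -> R).
Proof.
move=> cf mT; apply: (measurability _ (RGenOInfty.measurableE R)) => //.
move=> /= _ [_ [a ->] <-]; rewrite setTI; apply: sub_sigma_algebra.
by apply: open_comp; [move=> ? _; exact: cf|exact: interval_open].
Qed.

Lemma measurable_enorm : measurable_fun setT (@enorm R n : borelRn R n -> R).
Proof. exact: (continuous_measurable_borelRn (@enorm_continuous R n)). Qed.

Lemma measurable_kev e y : measurable_fun setT (kev e ^~ y : borelRn R n -> R).
Proof.
elim: e => [c|i|i||e1 IH1 e2 IH2|e1 IH1 e2 IH2] /=.
- exact: measurable_cst.
- exact: measurable_cst.
- exact: (continuous_measurable_borelRn (@coord_continuous R 1 n 0 i)).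
- rewrite (_ : (fun x : borelRn R n => _) =
      (fun t : R => t `^ (-1)) \o (fun x => enorm (y - x))).
    apply: measurableT_comp; first exact: measurable_powR.
    apply: (@continuous_measurable_borelRn (fun x => enorm (y - x))).
    have c x : {for x, continuous (fun x : 'rV[R]_n => enorm (y - x))}.
      apply: (@continuous_comp _ _ _ (fun z : 'rV[R]_n => y - z) (@enorm R n)).
        by apply: (@continuousB _ _ _ (fun=> y) (fun z : 'rV[R]_n => z));
          [exact: cst_continuous|exact: cvg_id].
      exact: enorm_continuous.
    exact: c.
  by apply/funext => x /=; rewrite powR_inv1// enorm_ge0.
- exact: measurable_funD.
- exact: measurable_funM.
Qed.

(** The integrand vanishes outside the closed ball, as [dist_ext] does. *)
Definition kcut e y (x : borelRn R n) : R := (enorm x <= rad)%R%:R * kev e x y.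

Lemma measurable_kcut e y : measurable_fun setT (kcut e y).
Proof.
apply: measurable_funM; last exact: measurable_kev.
have m : measurable_fun setT (fun x : borelRn R n => enorm x <= rad).
  by apply: measurable_fun_ler; [exact: measurable_enorm|exact: measurable_cst].
rewrite (_ : (fun x => _) = \1_[set x : borelRn R n | enorm x <= rad]).
  apply: measurable_indic.
  by have := m measurableT [set true]; rewrite setTI; apply.
apply/funext => x; rewrite indicE; case: (boolP (enorm x <= rad)%R) => h.
  by rewrite mem_set.
by rewrite memNset//=; exact/negP.
Qed.

Section Integrals.
Variable nu : {finite_measure set (borelRn R n) -> \bar R}.

Definition kint e y : R := (\int[nu]_x kcut e y x)%R.

Let mass : R := fine (nu setT).

Let mass_ge0 : 0 <= mass.
Proof. exact/fine_ge0. Qed.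

Lemma bounded_integrable (f : borelRn R n -> R) M :
  measurable_fun setT f -> (forall x, `|f x| <= M) ->
  nu.-integrable setT (EFin \o f).
Proof.
move=> mf fM; apply: measurable_bounded_integrable => //.
  by rewrite -ge0_fin_numE// fin_num_measure.
exists M; split; first exact: num_real.
by move=> z Mz x _; apply: le_trans (fM x) _; exact: ltW.
Qed.

Lemma Rintegral_norm_le (f : borelRn R n -> R) M :
  measurable_fun setT f -> (forall x, `|f x| <= M) ->
  `|\int[nu]_x f x| <= M * fine (nu setT).
Proof.
move=> mf fM; apply: le_trans (le_normr_Rintegral _ _) _ => //.
  exact: bounded_integrable fM.
rewrite -Rintegral_cst//; apply: le_Rintegral => //.
  apply: (@bounded_integrable _ M) => [|x]; first exact: measurableT_comp.
  by rewrite normr_id.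
apply: (@bounded_integrable _ `|M|) => // x; exact: measurable_cst.
Qed.

Lemma kcut_bounded e y : rad < enorm y -> exists M, forall x, `|kcut e y x| <= M.
Proof.
move=> ry; have [M M0 h] := kev_bounded e ry; exists M => x.
rewrite /kcut; case: (leP (enorm x) rad) => [xr|_]; rewrite ?mul1r ?h//.
by rewrite mul0r normr0.
Qed.

Lemma kcut_integrable e y : rad < enorm y ->
  nu.-integrable setT (EFin \o kcut e y).
Proof.
move=> ry; have [M h] := kcut_bounded e ry.
exact: bounded_integrable (measurable_kcut _ _) h.
Qed.

Lemma kintD e1 e2 y : rad < enorm y ->
  kint (KAdd e1 e2) y = kint e1 y + kint e2 y.
Proof.
move=> ry; rewrite /kint -RintegralD//; try exact: kcut_integrable.
by apply: eq_Rintegral => x _; rewrite /kcut /= mulrDr.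
Qed.

Lemma kintZ c e y : rad < enorm y -> kint (kscale c e) y = c * kint e y.
Proof.
move=> ry; rewrite /kint -RintegralZl//; last exact: kcut_integrable.
by apply: eq_Rintegral => x _; rewrite /kcut /= mulrCA.
Qed.

Lemma kint_eq0 e y : rad < enorm y -> e =k KConst 0 -> kint e y = 0.
Proof.
move=> ry e0; rewrite /kint; transitivity (\int[nu]_(x in setT) (0 : R))%R.
  apply: eq_Rintegral => x _; rewrite /kcut.
  case: (leP (enorm x) rad) => [xr|_]; last by rewrite mul0r.
  by rewrite mul1r e0//; exact: outside_neq ry.
by rewrite Rintegral_cst// mul0r.
Qed.

Lemma kint_sum F y : rad < enorm y -> kint (ksum F) y = \sum_i kint (F i) y.
Proof.
move=> ry; rewrite /ksum; elim: (index_enum _) => [|i s IH].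
  by rewrite !big_nil kint_eq0.
by rewrite !big_cons kintD// IH.
Qed.

Lemma kint_continuous e y : rad < enorm y -> {for y, continuous (kint e)}.
Proof.
move=> ry.
have [_ dist_le] :=
  @cvgrPdist_le R R^o _ (nbhs y) (nbhs_filter y) (kint e) (kint e y).
apply: dist_le => eps eps0.
(* 1 is added because the total mass may vanish *)
pose del := eps / (mass + 1).
have m1 : 0 < mass + 1 by rewrite ltr_wpDl.
have del0 : 0 < del by rewrite divr_gt0.
have nr := near_outside ry.
have ne := kev_equicontinuous e ry del0.
suff : \forall z \near y, `|kint e y - kint e z| <= eps by [].
apply: filterS2 nr ne => z rz uz.
rewrite /kint -RintegralB//; try exact: kcut_integrable.
apply: le_trans (@Rintegral_norm_le _ del _ _) _.
- by apply: measurable_funB; exact: measurable_kcut.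
- move=> x; rewrite /kcut; case: (leP (enorm x) rad) => [xr|_].
    by rewrite !mul1r distrC uz.
  by rewrite !mul0r subrr normr0 ltW.
- rewrite -/mass /del -mulrA -[leRHS]mulr1 ler_pM2l// mulrC ler_pdivrMr//.
  by rewrite mul1r lerDl.
Qed.

Lemma kev_increment_le e x y i (h r del df : R) :
  (forall t : R, `|t| < r -> t *: delta_mx 0 i + y != x /\
    `|kev (kpd i e) x (t *: delta_mx 0 i + y) - df| <= del) ->
  `|h| < r ->
  `|kev e x (h *: delta_mx 0 i + y) - kev e x y - h * df| <= del * `|h|.
Proof.
move=> hr hltr; pose v : 'rV[R]_n := delta_mx 0 i.
pose phi (t : R) := kev e x (t *: v + y).
have dphi (t : R) : `|t| < r ->
    is_derive t (1 : R) phi (kev (kpd i e) x (t *: v + y)).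
  by move=> /hr[tx _]; apply: is_derive_restr_line; exact: is_derive_kev.
have cphi (t : R) : `|t| < r -> {for t, continuous phi}.
  by move=> /dphi[/derivable1_diffP/differentiable_continuous].
have r00 : `|0 : R| < r by rewrite normr0 (le_lt_trans _ hltr).
have in_r (a b t : R) : `|a| < r -> `|b| < r -> t \in `[a, b] -> `|t| < r.
  rewrite !ltr_norml in_itv /= => /andP[ra _] /andP[_ br] /andP[a_t tb].
  by rewrite (lt_le_trans ra)//= (le_lt_trans tb).
have cc (a b : R) : `|a| < r -> `|b| < r -> {within `[a, b], continuous phi}.
  move=> ar br; apply: continuous_in_subspaceT => t /[1!inE] tab.
  by apply: cphi; exact: in_r tab.
have [c cr ->] : exists2 c, `|c| < r & kev e x (h *: v + y) - kev e x y =
    kev (kpd i e) x (c *: v + y) * h.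
  have -> : kev e x y = phi 0 by rewrite /phi scale0r add0r.
  have [hlt|hgt] := leP h 0.
    have [c ci] := MVT_segment hlt
      (fun t ti => dphi t (in_r _ _ _ hltr r00 (subset_itv_oo_cc ti)))
      (cc _ _ hltr r00).
    rewrite sub0r => E; exists c; first exact: in_r ci.
    by rewrite -[LHS]opprB E mulrN opprK.
  have [c ci] := MVT_segment (ltW hgt)
      (fun t ti => dphi t (in_r _ _ _ r00 hltr (subset_itv_oo_cc ti)))
      (cc _ _ r00 hltr).
  by rewrite subr0 => E; exists c => //; exact: in_r ci.
have [_ hc] := hr c cr.
by rewrite mulrC -mulrBr normrM mulrC ler_wpM2r// hc.
Qed.

(** Differentiation under the integral sign: by the mean value theorem the
    difference quotients of the kernel converge uniformly in the parameter. *)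
Lemma is_derive_kint e y i : rad < enorm y ->
  is_derive y (delta_mx 0 i) (kint e) (kint (kpd i e) y).
Proof.
move=> ry; apply: is_derive_line.
pose v : 'rV[R]_n := delta_mx 0 i.
have cl : {for (0 : R), continuous (fun t : R => t *: v + y)}.
  apply: (@continuousD _ _ _ (fun t : R => t *: v) (fun=> y)).
    exact: scalel_continuous.
  exact: cst_continuous.
have cv : (h^-1 *: (kint e (h *: v + y) - kint e y) @[h --> 0^'] -->
    kint (kpd i e) y).
  apply/cvgrPdist_le => eps eps0.
  pose del := eps / (mass + 1).
  have m1 : 0 < mass + 1 by rewrite ltr_wpDl.
  have del0 : 0 < del by rewrite divr_gt0.
  have : \forall t \near (0 : R), rad < enorm (t *: v + y) /\ forall x,
      enorm x <= rad -> `|kev (kpd i e) x (t *: v + y) - kev (kpd i e) x y| <= del.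
    have nP : \forall z \near ((0 : R) *: v + y), rad < enorm z /\ forall x,
        enorm x <= rad -> `|kev (kpd i e) x z - kev (kpd i e) x y| <= del.
      rewrite scale0r add0r; apply: filterI; first exact: near_outside.
      exact: kev_equicontinuous.
    exact: (cl _ nP).
  move=> /nbhs_ballP[r /= r0 hr].
  have {}hr t : `|t| < r -> rad < enorm (t *: v + y) /\ forall x,
      enorm x <= rad -> `|kev (kpd i e) x (t *: v + y) - kev (kpd i e) x y| <= del.
    by move=> tr; apply: hr; rewrite -ball_normE /= sub0r normrN.
  near=> h.
  have h0 : h != 0 by near: h; exact: nbhs_dnbhs_neq.
  have hltr : `|h| < r by near: h; exact: dnbhs0_lt.
  have [rh _] := hr h hltr.
  have mv x : enorm x <= rad ->
      `|kev e x (h *: v + y) - kev e x y - h * kev (kpd i e) x y| <= del * `|h|.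
    move=> xr; apply: (@kev_increment_le _ _ _ _ _ r) => // t /hr[rt ht].
    by split; [exact: outside_neq rt|exact: ht].
  have E : kint (kpd i e) y - h^-1 *: (kint e (h *: v + y) - kint e y) =
      - h^-1 * \int[nu]_x (kcut e (h *: v + y) x - kcut e y x -
                          h * kcut (kpd i e) y x)%R.
    rewrite RintegralB//.
    - rewrite RintegralB//; try exact: kcut_integrable.
      rewrite RintegralZl//; last exact: kcut_integrable.
      rewrite -!/(kint _ _) /GRing.scale/=; field.
      exact: h0.
    - exact: (integrableB measurableT (kcut_integrable e rh) (kcut_integrable e ry)).
    - exact: (integrableZl measurableT h (kcut_integrable (kpd i e) ry)).
  rewrite E normrM normrN normfV.
  apply: (@le_trans _ _ (`|h|^-1 * (del * `|h| * mass))).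
    rewrite ler_wpM2l ?invr_ge0//; apply: Rintegral_norm_le.
      apply: measurable_funB; last first.
        by apply: measurable_funM; [exact: measurable_cst|exact: measurable_kcut].
      by apply: measurable_funB; exact: measurable_kcut.
    move=> x; rewrite /kcut; case: (leP (enorm x) rad) => [xr|_].
      by rewrite !mul1r mv.
    by rewrite !mul0r mulr0 !subr0 normr0 mulr_ge0// ltW.
  rewrite mulrAC mulrCA mulVf ?normr_eq0// mulr1.
  rewrite /del -mulrA -[leRHS]mulr1 ler_pM2l// mulrC ler_pdivrMr//.
  by rewrite mul1r lerDl.
have E : (fun h : R => h^-1 *: (kint e (h *: v + y) - kint e y)) =
    (fun h : R => h^-1 *: (((fun t : R => kint e (t *: v + y)) \o shift 0) (h *: 1)
      - (fun t : R => kint e (t *: v + y)) 0)).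
  by apply/funext => h /=; rewrite addr0 [_%:A]mulr1 scale0r add0r.
rewrite E in cv; split; last exact: cvg_lim cv.
by apply/cvg_ex; exists (kint (kpd i e) y).
Unshelve. all: by end_near. Qed.

End Integrals.
End KernelIntegral.

Section SmoothOn.
Variables (R : realType) (n : nat).
Implicit Types (U : set 'rV[R]_n) (u v : 'rV[R]_n -> R).

Lemma near_eq_on U u v x : open U -> (forall y, U y -> u y = v y) -> U x ->
  \forall y \near x, u y = v y.
Proof.
move=> oU uv Ux; have nU : \forall y \near x, U y by apply: open_nbhs_nbhs; split.
by apply: filterS nU.
Qed.

Lemma partial_eq_on U u v i : open U -> (forall y, U y -> u y = v y) ->
  forall y, U y -> partial i u y = partial i v y.
Proof. by move=> oU uv y Uy; apply: near_eq_derive; exact: near_eq_on uv Uy. Qed.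

Lemma Ck_on_eq k U u v : open U -> (forall y, U y -> u y = v y) ->
  Ck_on k U u -> Ck_on k U v.
Proof.
move=> oU; have ct (f g : 'rV[R]_n -> R) : (forall y, U y -> f y = g y) ->
    (forall x, U x -> {for x, continuous f}) ->
    forall x, U x -> {for x, continuous g}.
  move=> fg cf x Ux.
  have nx := near_eq_on oU fg Ux.
  have c : f y @[y --> x] --> g x by rewrite -fg//; exact: cf.
  exact: cvg_trans (near_eq_cvg nx) c.
elim: k u v => [|k IH] u v uv [cu du]; split.
- by move=> x Ux; exact: (ct u v uv cu x Ux).
- by [].
- by move=> x Ux; exact: (ct u v uv cu x Ux).
- move=> i; have [d c] := du i; split.
    by move=> x Ux; apply: near_eq_derivable (d x Ux); exact: near_eq_on uv Ux.
  by apply: IH c => y Uy; exact: (partial_eq_on i oU uv).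
Qed.

Lemma real_laplacian_eq_on U u v : open U -> (forall y, U y -> u y = v y) ->
  forall y, U y -> real_laplacian u y = real_laplacian v y.
Proof.
move=> oU uv y Uy; apply: eq_bigr => i _.
by apply: (partial_eq_on i oU) Uy => z Uz; exact: (partial_eq_on i oU uv).
Qed.

End SmoothOn.

Section ChargeIntegral.
Variables (R : realType) (n : nat) (rad : R).
Variable mu : {charge set (borelRn R n) -> \bar R}.
Implicit Types (x y : 'rV[R]_n) (i j : 'I_n) (e : kexpr R n).
Local Notation U := [set y : 'rV[R]_n | rad < enorm y].

Definition kcharge e y : R := charge_integral mu (kcut rad e y).

Lemma kchargeE e y : kcharge e y =
  kint rad (jordan_pos (hahn_pos_neg mu)) e y -
  kint rad (jordan_neg (hahn_pos_neg mu)) e y.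
Proof. by []. Qed.

Lemma is_derive_kcharge e y i : U y ->
  is_derive y (delta_mx 0 i) (kcharge e) (kcharge (kpd i e) y).
Proof. by move=> Uy; apply: is_deriveB; exact: is_derive_kint. Qed.

Lemma kcharge_continuous e y : U y -> {for y, continuous (kcharge e)}.
Proof. by move=> Uy; apply: continuousB; exact: kint_continuous. Qed.

Lemma kcharge_eq0 e y : U y -> e =k KConst 0 -> kcharge e y = 0.
Proof. by move=> Uy e0; rewrite kchargeE !kint_eq0// subrr. Qed.

Lemma kcharge_lap e y : U y ->
  kcharge (klap e) y = \sum_i kcharge (kpd i (kpd i e)) y.
Proof. by move=> Uy; rewrite kchargeE !kint_sum// -sumrB. Qed.

Lemma kchargeZ c e y : U y -> kcharge (kscale c e) y = c * kcharge e y.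
Proof. by move=> Uy; rewrite !kchargeE !kintZ// mulrBr. Qed.

Lemma partial_kcharge i e y : U y -> partial i (kcharge e) y = kcharge (kpd i e) y.
Proof. by move=> Uy; have [] := is_derive_kcharge e i Uy. Qed.

Lemma Ck_on_kcharge k e : Ck_on k U (kcharge e).
Proof.
elim: k e => [|k IH] e; split; try by move=> x; exact: kcharge_continuous.
  by [].
move=> i; split; first by move=> x Ux; have [] := is_derive_kcharge e i Ux.
apply: Ck_on_eq (IH (kpd i e)); first exact: open_outside.
by move=> y Uy; rewrite partial_kcharge.
Qed.

Lemma iter_laplacian_kcharge k u e : (forall y, U y -> u y = kcharge e y) ->
  forall y, U y -> iter k (@real_laplacian R n) u y = kcharge (klapn k e) y.
Proof.
have oU : open U by exact: open_outside.
move=> ue; elim: k => [|k IH] y Uy; first exact: ue.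
rewrite iterS (real_laplacian_eq_on oU IH Uy) /klapn iterS kcharge_lap//.
apply: eq_bigr => i _.
rewrite -partial_kcharge//; apply: (partial_eq_on i oU) Uy => z Uz.
exact: partial_kcharge.
Qed.

Lemma kcharge_polyharmonic N u e : (forall y, U y -> u y = kcharge e y) ->
  klapn N e =k KConst 0 ->
  (forall k, Ck_on k U u) /\
  forall y, U y -> iter N (@real_laplacian R n) u y = 0.
Proof.
move=> ue e0; split => [k|y Uy].
  apply: Ck_on_eq (Ck_on_kcharge k e); first exact: open_outside.
  by move=> y Uy; rewrite ue.
by rewrite (iter_laplacian_kcharge _ ue)// kcharge_eq0.
Qed.

End ChargeIntegral.

(** * The analytic continuation of the distance *)

Section ComplexDistance.

(** Stated over an abstract field, so that for complex functions the topology is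
    the one given by the modulus. *)
Definition continuous_at_point (K : numFieldType) (g : K -> K) (z : K) :=
  {for z, continuous g}.

Lemma near_neq0 (K : numFieldType) (z : K) : z != 0 -> \forall w \near z, w != 0.
Proof.
move=> z0; apply/nbhs_ballP; exists `|z|; first by rewrite /= normr_gt0.
move=> w; rewrite -ball_normE /=; apply: contraTneq => ->.
by rewrite subr0 ltxx.
Qed.

(** The difference quotient of [g] is that of the quadratic polynomial divided
    by [g (z + h) + g z], which tends to [2 g z]. *)
Lemma derivable_sqrt_quadratic (K : numFieldType) (g : K -> K) (b c z : K) :
  (forall w, w != 0 -> g w ^+ 2 = w ^+ 2 - b * w + c) -> z != 0 ->
  continuous_at_point g z -> g z != 0 -> derivable g z 1.
Proof.
move=> gq' z0 gc gz.
have gq : \forall w \near z, g w ^+ 2 = w ^+ 2 - b * w + c.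
  by apply: filterS (near_neq0 z0) => w; exact: gq'.
apply/cvg_ex; exists ((z + z - b) / (g z + g z)).
have gz2 : g z + g z != 0 by rewrite -mulr2n mulrn_eq0.
have c0 : (fun h : K => h + z) @ 0^' --> z.
  rewrite -[X in _ --> X]add0r.
  by apply: cvgD; [exact: nbhs_dnbhs|exact: cvg_cst].
have gc0 : (fun h : K => g (h + z) + g z) @ 0^' --> g z + g z.
  by apply: cvgD; [exact: (cvg_comp _ _ c0 gc)|exact: cvg_cst].
have lim : (fun h : K => ((h + z) + z - b) / (g (h + z) + g z)) @ 0^' -->
    (z + z - b) / (g z + g z).
  apply: cvgM; last exact: cvgV.
  by apply: cvgB; [apply: cvgD; [exact: c0|exact: cvg_cst]|exact: cvg_cst].
apply: cvg_trans lim; apply: near_eq_cvg; near=> h.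
have h0 : h != 0 by near: h; exact: nbhs_dnbhs_neq.
have gh : g (h + z) ^+ 2 = (h + z) ^+ 2 - b * (h + z) + c.
  by near: h; exact: (c0 _ gq).
have gz' : g z ^+ 2 = z ^+ 2 - b * z + c by exact: (nbhs_singleton gq).
have s0 : g (h + z) + g z != 0 by near: h; exact: (gc0 _ (near_neq0 gz2)).
rewrite /= [h%:A]mulr1 /GRing.scale/=.
apply: (mulfI h0); apply: (mulIf s0); rewrite -!mulrA mulVf// mulr1 mulrA.
rewrite mulfV// mul1r.
transitivity (g (h + z) ^+ 2 - g z ^+ 2); last by ring.
by rewrite gh gz'; ring.
Unshelve. all: by end_near. Qed.

Lemma continuous_lipschitz_at (K : numFieldType) (s : K -> K) (w p : K) :
  0 < p -> (forall v, `|s v - s w| * p <= `|v - w|) -> continuous_at_point s w.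
Proof.
move=> p0 h.
have [_ dist_lt] := @cvgrPdist_lt K K^o _ (nbhs w) (nbhs_filter w) s (s w).
apply: dist_lt => e e0.
have ep : 0 < e * p by rewrite mulr_gt0.
apply/nbhs_ballP; exists (e * p) => // v; rewrite -ball_normE /= => vw.
rewrite -(ltr_pM2r p0) (le_lt_trans _ vw)// distrC [leRHS]distrC.
exact: h.
Qed.

Lemma continuous_branch (K : numFieldType) (s : K -> K) (a b z : K) : z != 0 ->
  continuous_at_point s (1 - a / z) -> continuous_at_point s (1 - b / z) ->
  continuous_at_point (fun z : K => z * s (1 - a / z) * s (1 - b / z)) z.
Proof.
move=> z0 ca cb.
have cs c : continuous_at_point s (1 - c / z) ->
    {for z, continuous (fun z : K => s (1 - c / z))}.
  move=> sc; apply: (@continuous_comp _ _ _ (fun z : K => 1 - c / z) s) => //.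
  apply: (@continuousB _ _ _ (fun=> 1 : K) (fun z : K => c / z)).
    exact: cst_continuous.
  apply: (@continuousM _ _ (fun=> c : K) (fun z : K => z^-1)).
    exact: cst_continuous.
  by apply: (@continuousV _ _ (fun z : K => z)) => //; exact: cvg_id.
apply: (@continuousM _ _ (fun z : K => z * s (1 - a / z))); last exact: cs.
by apply: (@continuousM _ _ (fun z : K => z)); [exact: cvg_id|exact: cs].
Qed.

Variable R : realType.
Local Notation C := R[i].
Implicit Types (w z : C).

Lemma Re_sqrtc_ge0 w : 0 <= complex.Re (sqrtc w).
Proof. by case: w => a b /=; exact: sqrtr_ge0. Qed.

Lemma Re_sqrtc_gt0 w : 0 < complex.Re w -> 0 < complex.Re (sqrtc w).
Proof.
case: w => a b /= a0; by rewrite sqrtr_gt0 divr_gt0// ltr_wpDl// sqrtr_ge0.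
Qed.

(** In [v - w = (sqrt v - sqrt w) (sqrt v + sqrt w)] the modulus of the last
    factor is at least [Re (sqrt w)]. *)
Lemma sqrtc_continuous w : 0 < complex.Re w ->
  continuous_at_point (K := R[i]) (@sqrtc R) w.
Proof.
move=> w0; have p0 := Re_sqrtc_gt0 w0.
apply: (@continuous_lipschitz_at _ _ _ (complex.Re (sqrtc w))%:C).
  by rewrite ltcR.
move=> v; have -> : v - w = (sqrtc v - sqrtc w) * (sqrtc v + sqrtc w).
  by rewrite -subr_sqr !sqr_sqrtc.
rewrite normrM ler_wpM2l//; apply: le_trans (normc_ge_Re _).
rewrite lecR raddfD/= (le_trans _ (ler_norm _))// lerDr.
exact: Re_sqrtc_ge0.
Qed.

Lemma sqrtc_conj w : 0 < complex.Re w -> sqrtc (w^*)%C = ((sqrtc w)^*)%C.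
Proof.
move=> w0; have : sqrtc (w^*)%C ^+ 2 = ((sqrtc w)^*)%C ^+ 2.
  by rewrite sqr_sqrtc -rmorphXn sqr_sqrtc.
move/eqP; rewrite eqf_sqr => /orP[/eqP//|/eqP E].
have := Re_sqrtc_gt0 w0; have := Re_sqrtc_ge0 (w^*)%C.
rewrite E; case: (sqrtc w) => a b /=.
by rewrite oppr_ge0 => a1 a2; have := lt_le_trans a2 a1; rewrite ltxx.
Qed.

Lemma Re_1B_gt0 (a : C) z : `|a| < `|z| -> 0 < complex.Re (1 - a / z).
Proof.
move=> az; have z0 : 0 < `|z| by exact: le_lt_trans az.
have : `|a / z| < 1 by rewrite normrM normfV ltr_pdivrMr// mul1r.
move=> /(le_lt_trans (normc_ge_Re _)); rewrite -[1]/(1%:C) ltcR => h.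
rewrite raddfB/= subr_gt0; exact: le_lt_trans (ler_norm _) h.
Qed.

Variables (n : nat) (rad : R).
Implicit Types (x theta : 'rV[R]_n).

(** Since [|rho theta - x|^2 = (rho - a) (rho - a')] with [a'] conjugate to [a]
    and [|a| = |x|], the continuation is [z sqrt(1 - a/z) sqrt(1 - a'/z)]: for [|z| > |a|] the
    arguments of the square roots have positive real part, where the principal
    branch is continuous, and on the real axis they are conjugate. *)
Lemma dist_continuation_exists theta x : enorm theta = 1 -> enorm x <= rad ->
  exists g, is_dist_continuation rad theta x g.
Proof.
move=> th1 xr.
pose t := \sum_i theta 0 i * x 0 i.
have qE (r : R) : enorm (r *: theta - x) ^+ 2 =
    r ^+ 2 - 2 * t * r + enorm x ^+ 2.
  have -> : r ^+ 2 = r ^+ 2 * enorm theta ^+ 2 by rewrite th1 expr1n mulr1.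
  rewrite !sqr_enorm /t !mulr_sumr mulr_suml -sumrB -big_split.
  by apply: eq_bigr => i _ /=; rewrite !mxE; ring.
have tx : 0 <= enorm x ^+ 2 - t ^+ 2.
  have := sqr_ge0 (enorm (t *: theta - x)); rewrite qE.
  by have -> : t ^+ 2 - 2 * t * t + enorm x ^+ 2 = enorm x ^+ 2 - t ^+ 2 by ring.
(* a root of z^2 - 2 t z + |x|^2; the other one is its conjugate *)
pose a : C := t +i* Num.sqrt (enorm x ^+ 2 - t ^+ 2).
have aN : `|a| = (enorm x)%:C.
  rewrite normc_def /= sqr_sqrtr// addrC subrK sqrtr_sqr ger0_norm//.
  exact: enorm_ge0.
have aJN : `|(a^*)%C| = (enorm x)%:C.
  by rewrite -aN !normc_def; case: (a) => ? ? /=; rewrite sqrrN.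
have aJ z : (z - a) * (z - (a^*)%C) = z ^+ 2 - (2 * t)%:C * z + (enorm x ^+ 2)%:C.
  have -> : (2 * t)%:C = a + (a^*)%C.
    by rewrite addcJ /a /= rmorphM /= rmorph_nat.
  have -> : (enorm x ^+ 2)%:C = a * (a^*)%C.
    rewrite rmorphXn /= -aN [`|a| ^+ 2]sqr_normc//.
  by ring.
pose g z := z * sqrtc (1 - a / z) * sqrtc (1 - (a^*)%C / z).
have gq z : z != 0 -> g z ^+ 2 = z ^+ 2 - (2 * t)%:C * z + (enorm x ^+ 2)%:C.
  move=> z0; rewrite /g !exprMn !sqr_sqrtc -aJ; field.
  exact: z0.
have az z : rad%:C < `|z| -> `|a| < `|z|.
  by rewrite aN; apply: le_lt_trans; rewrite lecR.
have aJz z : rad%:C < `|z| -> `|(a^*)%C| < `|z|.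
  by rewrite aJN; apply: le_lt_trans; rewrite lecR.
exists g; split.
  move=> z /= rz; have z0 : z != 0.
    by rewrite -normr_gt0; exact: le_lt_trans (az _ rz).
  have Ra := Re_1B_gt0 (az _ rz); have Rb := Re_1B_gt0 (aJz _ rz).
  apply: (@derivable_sqrt_quadratic _ g (2 * t)%:C (enorm x ^+ 2)%:C) => //.
  - by apply: continuous_branch => //; exact: sqrtc_continuous.
  - have s0 (w : C) : 0 < complex.Re w -> sqrtc w != 0.
      by move=> w0; rewrite sqrtc_eq0; apply: contraTneq w0 => ->; rewrite ltxx.
    by rewrite /g !mulf_neq0// s0.
move=> rho rrho.
have rho0 : 0 < rho by apply: le_lt_trans rrho; apply: le_trans xr; exact: enorm_ge0.
have rz : rad%:C < `|rho%:C| by rewrite ger0_norm ?ler0c ?ltW// ltcR.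
have gE : g rho%:C = rho%:C * (sqrtc (1 - a / rho%:C) *
    ((sqrtc (1 - a / rho%:C))^*)%C).
  rewrite -sqrtc_conj; last exact: Re_1B_gt0 (az _ rz).
  have -> : ((1 - a / rho%:C)^*)%C = 1 - (a^*)%C / rho%:C.
    move: (a) => b.
    by rewrite rmorphB rmorph1; congr (_ - _); rewrite rmorphM;
      congr (_ * _); apply: etrans (conjc_inv _) _; rewrite conjc_real.
  by rewrite mulrA.
have g0 : 0 <= g rho%:C by rewrite gE mulr_ge0 ?ler0c ?(ltW rho0)// mulcJ_ge0.
have d0 : 0 <= (enorm (rho *: theta - x))%:C by rewrite ler0c enorm_ge0.
apply/eqP; rewrite -(eqrXn2 (ltn0Sn 1) g0 d0).
rewrite gq; last by rewrite gt_eqF// ltcR.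
have -> : (enorm (rho *: theta - x))%:C ^+ 2 = (enorm (rho *: theta - x) ^+ 2)%:C.
  by rewrite rmorphXn.
have lin (r b c : R) : (r ^+ 2 - b * r + c)%:C = r%:C ^+ 2 - b%:C * r%:C + c%:C.
  by rewrite rmorphD rmorphB; congr (_ - _ + _); [rewrite rmorphXn|rewrite rmorphM].
by rewrite qE lin.
Qed.

Lemma dist_extE theta x rho : enorm theta = 1 -> enorm x <= rad -> rad < rho ->
  dist_ext rad theta x rho%:C = (enorm (rho *: theta - x))%:C.
Proof.
move=> th1 xr rrho; rewrite /dist_ext.
have [g gP] := dist_continuation_exists th1 xr.
set A := [set g | _]; have /(xgetPex (fun=> 0)) : exists g, A g by exists g.
by case=> _ [_ ->].
Qed.

Lemma dist_ext_outside theta x z : rad < enorm x -> dist_ext rad theta x z = 0.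
Proof.
move=> rx; rewrite /dist_ext xgetPN// => g [] xr.
by have := lt_le_trans rx xr; rewrite ltxx.
Qed.

End ComplexDistance.

(** * Polynomials and polyharmonic degrees *)

Section ComplexPolynomials.
Import (canonicals) mathcomp.multinomials.mpoly.
Variables (R : realType) (n : nat).
Hypothesis n_gt0 : (0 < n)%N.
Local Notation C := R[i].
Implicit Types (x y : 'rV[R]_n) (i j : 'I_n) (a b c d h : kexpr R n).
Implicit Types (f g : 'rV[R]_n -> C).

Definition represents f a b :=
  kpoly a /\ kpoly b /\ forall x y, f y = kev a x y +i* kev b x y.

Lemma representsM f g a b c d : represents f a b -> represents g c d ->
  represents (fun y => f y * g y)
    (KAdd (KMul a c) (kscale (-1) (KMul b d))) (KAdd (KMul a d) (KMul b c)).
Proof.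
move=> [pa [pb fE]] [pc [pd gE]]; do 2 (split; first by rewrite /= pa pb pc pd).
move=> x y; rewrite (fE x) (gE x); simpc; congr (_ +i* _) => /=; ring.
Qed.

Lemma represents_sum (I : Type) (s : seq I) (F : I -> 'rV[R]_n -> C) :
  (forall k, exists a b, represents (F k) a b) ->
  exists a b, represents (fun y => \sum_(k <- s) F k y) a b.
Proof.
move=> hF; elim: s => [|k s [a [b [pa [pb ih]]]]].
  by exists (KConst 0), (KConst 0); do 2 split=> //; move=> x y; rewrite big_nil.
have [c [d [pc [pd Fk]]]] := hF k.
exists (KAdd c a), (KAdd d b).
do 2 (split; first by rewrite /= ?pa ?pb ?pc ?pd).
by move=> x y; rewrite big_cons (Fk x) (ih x).
Qed.

Lemma represents_prod (I : Type) (s : seq I) (F : I -> 'rV[R]_n -> C) :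
  (forall k, exists a b, represents (F k) a b) ->
  exists a b, represents (fun y => \prod_(k <- s) F k y) a b.
Proof.
move=> hF; elim: s => [|k s [a [b ih]]].
  by exists (KConst 1), (KConst 0); do 2 split=> //; move=> x y; rewrite big_nil.
have [c [d Fk]] := hF k.
have [p [q H]] := representsM Fk ih.
do 2 eexists; split; first exact: p.
by split; [exact: q|move=> x y; rewrite big_cons; exact: H].
Qed.

Lemma represents_pfun (P : cpoly R n) : exists a b, represents (pfun P) a b.
Proof.
have -> : pfun P = fun y => \sum_(m <- mpoly.msupp P)
    mpoly.mcoeff m P * \prod_i (y 0 i)%:C ^+ (mpoly.fun_of_multinom m i).
  by apply/funext => y; exact: mpoly.mevalE.
apply: represents_sum => m.
have [a [b H]] : exists a b,
    represents (fun y => \prod_i (y 0 i)%:C ^+ (mpoly.fun_of_multinom m i)) a b.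
  apply: represents_prod => i.
  have [a [b H]] : exists a b,
      represents (fun y => \prod_(k <- iota 0 (mpoly.fun_of_multinom m i)) (y 0 i)%:C) a b.
    by apply: represents_prod => _; exists (KY i), (KConst 0).
  exists a, b; case: H => pa [pb H]; do 2 split=> //; move=> x y.
  by rewrite -(H x) big_const_seq count_predT size_iota -Monoid.iteropE.
pose z := mpoly.mcoeff m P.
have Hz : represents (fun=> z) (KConst (complex.Re z)) (KConst (complex.Im z)).
  by do 2 split=> //; move=> x y; case: (z).
by do 2 eexists; exact: representsM Hz H.
Qed.

Lemma pfun_kpoly h : kpoly h ->
  exists H : cpoly R n, represents (pfun H) h (KConst 0).
Proof.
elim: h => //= [c _|i _|e1 IH1 e2 IH2 /andP[p1 p2]|e1 IH1 e2 IH2 /andP[p1 p2]].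
- exists (mpoly.mpolyC n c%:C); do 2 split=> //; move=> x y.
  exact: mpoly.mevalC.
- exists (mpoly.mpolyX C (mpoly.mnm1 i)); do 2 split=> //; move=> x y.
  exact: mpoly.mevalXU.
- have [H1 [_ [_ h1]]] := IH1 p1; have [H2 [_ [_ h2]]] := IH2 p2.
  exists ((H1 : mpoly.mpoly n C) + (H2 : mpoly.mpoly n C)).
  split; first by rewrite /= p1 p2.
  split=> // x y; rewrite /pfun /peval mpoly.mevalD.
  by rewrite -[mpoly.meval _ H1]/(pfun H1 y) -[mpoly.meval _ H2]/(pfun H2 y)
    (h1 x) (h2 x) /=; simpc.
- have [H1 [_ [_ h1]]] := IH1 p1; have [H2 [_ [_ h2]]] := IH2 p2.
  exists ((H1 : mpoly.mpoly n C) * (H2 : mpoly.mpoly n C)).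
  split; first by rewrite /= p1 p2.
  split=> // x y; rewrite /pfun /peval mpoly.mevalM.
  by rewrite -[mpoly.meval _ H1]/(pfun H1 y) -[mpoly.meval _ H2]/(pfun H2 y)
    (h1 x) (h2 x) /=; simpc.
Qed.

Lemma kpoly_pd i a : kpoly a -> kpoly (kpd i a).
Proof.
elim: a => //= [e1 IH1 e2 IH2 /andP[/IH1-> /IH2->]//|e1 IH1 e2 IH2].
by move=> /andP[p1 p2]; rewrite p1 p2 IH1// IH2.
Qed.

Lemma kpoly_lap a : kpoly a -> kpoly (klap a).
Proof. by move=> pa; apply: kpoly_sum => i; do 2 apply: kpoly_pd. Qed.

Lemma kpoly_parameter a x x' y : kpoly a -> kev a x y = kev a x' y.
Proof. by elim: a => //= e1 IH1 e2 IH2 /andP[/IH1-> /IH2->]. Qed.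

Lemma exists_neq y : exists x, y != x.
Proof.
exists (y + delta_mx 0 (Ordinal n_gt0)).
rewrite -subr_eq0 opprD addNKr oppr_eq0; apply/eqP => /matrixP /(_ 0 (Ordinal n_gt0)).
by rewrite !mxE !eqxx => /eqP; rewrite oner_eq0.
Qed.

(** A polynomial expression does not involve [x], so that at each [y] the
    parameter may be chosen off the diagonal. *)
Lemma real_laplacian_kpoly a u x y : kpoly a -> (forall y, u y = kev a x y) ->
  real_laplacian u y = kev (klap a) x y.
Proof.
move=> pa uE; have [x' yx'] := exists_neq y.
rewrite (kpoly_parameter x x' y (kpoly_lap pa)).
have -> : u = kev a x'.
  by apply/funext => z; rewrite uE; exact: kpoly_parameter.
rewrite kev_lap; apply: eq_bigr => i _.
have [_ <-] := is_derive_kev (kpd i a) i yx'.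
apply: near_eq_derive; apply: filterS (near_neq yx') => z zx'.
by have [] := is_derive_kev a i zx'.
Qed.

Lemma represents_laplacian f a b : represents f a b ->
  represents (laplacian f) (klap a) (klap b).
Proof.
move=> [pa [pb fE]]; do 2 (split; first exact: kpoly_lap).
move=> x y; rewrite /laplacian.
by congr (_ +i* _); apply: real_laplacian_kpoly => // z; rewrite (fE x).
Qed.

Lemma represents_iter k f a b : represents f a b ->
  represents (iter k (@laplacian R n) f) (klapn k a) (klapn k b).
Proof. by move=> fab; elim: k => //= k; exact: represents_laplacian. Qed.

Lemma represents_iter0 k f a b : represents f a b ->
  (forall y, iter k (@laplacian R n) f y = 0) <->
  klapn k a =k KConst 0 /\ klapn k b =k KConst 0.
Proof.
move=> /(represents_iter k)[_ [_ fE]]; split=> [f0|[a0 b0] y].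
  by split=> x y _; have := f0 y; rewrite (fE x) => -[].
by have [x yx] := exists_neq y; rewrite (fE x) a0// b0.
Qed.

Lemma polyharmonic_degreeP f k : (forall y, iter k.+1 (@laplacian R n) f y = 0) ->
  (polyharmonic_degree f <= k)%N /\
  forall y, iter (polyharmonic_degree f).+1 (@laplacian R n) f y = 0.
Proof.
move=> fk; pose A N := forall y, iter N.+1 (@laplacian R n) f y = 0.
have [m mA mmin] : exists2 m, A m & forall m', A m' -> (m <= m')%N.
  have exA : exists m, `[< A m >] by exists k; apply/asboolP.
  case: (ex_minnP exA) => m /asboolP mA mmin; exists m => // m' m'A.
  exact/mmin/asboolP.
have [dA dmin] : A (polyharmonic_degree f) /\
    forall m', A m' -> (polyharmonic_degree f <= m')%N.
  apply: (@xgetPex _ 0%N [set N | A N /\ forall N', A N' -> (N <= N')%N]).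
  by exists m.
exact: (conj (dmin k fk) dA).
Qed.

Lemma harmonic_degree_bound (P : cpoly R n) : exists M, forall H : cpoly R n,
  harmonic_fun (pfun H) ->
  forall y, iter M.+1 (@laplacian R n) (fun x => pfun P x * pfun H x) y = 0.
Proof.
have [a [b rP]] := represents_pfun P; have [pa [pb _]] := rP.
have [M1 h1] := kpoly_degree_bound pa; have [M2 h2] := kpoly_degree_bound pb.
exists (maxn M1 M2) => H harm.
have [c [d rH]] := represents_pfun H.
have [c0 d0] := (represents_iter0 1 rH).1 harm.
apply/(represents_iter0 _ (representsM rP rH)).
have k1 e : klapn 1 e =k KConst 0 -> klapn (maxn M1 M2).+1 (KMul a e) =k KConst 0.
  by move=> /h1; apply: klapn_le; rewrite add1n ltnS leq_maxl.
have k2 e : klapn 1 e =k KConst 0 -> klapn (maxn M1 M2).+1 (KMul b e) =k KConst 0.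
  by move=> /h2; apply: klapn_le; rewrite add1n ltnS leq_maxr.
split=> x y yx.
  rewrite klapnD// kevD k1// (klapnZ _ _ (kscalarC _) yx) kevM k2//.
  by rewrite mulr0 addr0.
by rewrite klapnD// kevD k1// k2// addr0.
Qed.

(** The degrees being bounded, [poly_degree_sup] is an upper bound of them and
    not the default value of [supremum].  Real harmonic polynomials [h] suffice
    below, and for them the real and imaginary parts of [P h] separate. *)
Lemma poly_degree_supP (P : cpoly R n) a b h : represents (pfun P) a b ->
  kpoly h -> klap h =k KConst 0 ->
  klapn (poly_degree_sup P).+1 (KMul a h) =k KConst 0 /\
  klapn (poly_degree_sup P).+1 (KMul b h) =k KConst 0.
Proof.
move=> rP ph h0.
have [M hM] := harmonic_degree_bound P.
have [H rH] := pfun_kpoly ph.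
have harm : harmonic_fun (pfun H).
  apply/(represents_iter0 1 rH); split=> //; exact: klapn0.
pose S := [set polyharmonic_degree (fun x => pfun P x * pfun h x)
       | h in [set h : cpoly R n | harmonic_fun (pfun h)]].
have Sub : ubound S M.
  move=> _ [K harmK <-]; exact: (polyharmonic_degreeP (hM K harmK)).1.
set f := fun x => pfun P x * pfun H x.
have degS : S (polyharmonic_degree f) by exists H.
have le_sup : (polyharmonic_degree f <= poly_degree_sup P)%N.
  apply: (ge_supremum_Nmem 0%N (t := polyharmonic_degree f)) => //.
  by apply: nat_supremums_neq0; exists M.
have [_ fdeg] := polyharmonic_degreeP (hM H harm).
have [k1 k2] := (represents_iter0 _ (representsM rP rH)).1 fdeg.
have le1 : ((polyharmonic_degree f).+1 <= (poly_degree_sup P).+1)%N by [].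
split; [apply: keq_trans (klapn_le le1 k1)|apply: keq_trans (klapn_le le1 k2)];
  by apply: klapn_eq => x y _ /=; ring.
Qed.

End ComplexPolynomials.

(** * The function of the second kind *)

Section SecondKind.
Variables (R : realType) (n : nat) (rad : R).
Hypotheses (n_gt0 : (0 < n)%N) (rad_gt0 : 0 < rad).
Variable mu : {charge set (borelRn R n) -> \bar R}.
Implicit Types (x y : 'rV[R]_n) (a b : kexpr R n).
Local Notation C := R[i].

(** For [a] the real or imaginary part of [P], the corresponding part of the
    integrand of the function of the second kind, without [|y|^(n-1)]. *)
Definition second_kind_kernel a : kexpr R n := KMul (kdiff a) (kinvn n).

Lemma iter_laplacianE k (f : 'rV[R]_n -> C) y :
  iter k (@laplacian R n) f y =
  iter k (@real_laplacian R n) (fun y => complex.Re (f y)) y +i*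
  iter k (@real_laplacian R n) (fun y => complex.Im (f y)) y.
Proof.
elim: k y => [|k IH] y; first by rewrite /=; case: (f y).
rewrite iterS; have -> : iter k (@laplacian R n) f = fun z => _ := funext IH.
exact: erefl.
Qed.

Lemma second_kind_integrand (P : cpoly R n) a b x y : represents (pfun P) a b ->
  rad < enorm y ->
  (peval P (fun i => (enorm y)%:C * (((enorm y)^-1 *: y) 0 i)%:C) - pfun P x)
    / dist_ext rad ((enorm y)^-1 *: y) x (enorm y)%:C ^+ n * (enorm y)%:C ^+ n.-1
  = kcut rad (kscale (enorm y ^+ n.-1) (second_kind_kernel a)) y x
    +i* kcut rad (kscale (enorm y ^+ n.-1) (second_kind_kernel b)) y x.
Proof.
move=> [pa [pb PE]] ry.
have y0 : enorm y != 0 by rewrite gt_eqF// (lt_trans rad_gt0).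
rewrite /kcut; have [xr|rx] := leP (enorm x) rad; last first.
  by rewrite dist_ext_outside// expr0n gtn_eqF// invr0 mulr0 !mul0r.
have th1 : enorm ((enorm y)^-1 *: y) = 1.
  apply/eqP; rewrite -(eqrXn2 (ltn0Sn 1) (enorm_ge0 _) ler01) expr1n sqr_enorm.
  under eq_bigr do rewrite mxE exprMn.
  by rewrite -mulr_sumr -sqr_enorm exprVn mulVf// sqrf_eq0.
rewrite dist_extE// scalerA mulfV// scale1r.
have -> : (fun i => (enorm y)%:C * (((enorm y)^-1 *: y) 0 i)%:C) =
    (fun i => (y 0 i)%:C).
  by apply/funext => i; rewrite mxE -rmorphM/= mulrA mulfV// mul1r.
rewrite -/(pfun P y) (PE x y) (PE x x) !mul1r.
have CE (z : C) (s t : R) : z / s%:C ^+ n * t%:C ^+ n.-1 =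
    (t ^+ n.-1 * (complex.Re z * s^-1 ^+ n)) +i*
    (t ^+ n.-1 * (complex.Im z * s^-1 ^+ n)).
  rewrite -exprVn -fmorphV -!rmorphXn.
  by case: z => u v; simpc; congr (_ +i* _) => /=; ring.
by rewrite CE /= !kev_invn !kev_diag//= !mulN1r.
Qed.

Lemma second_kindE (P : cpoly R n) a b y : represents (pfun P) a b ->
  rad < enorm y ->
  (enorm y)%:C ^- n.-1 * second_kind rad mu P (enorm y)%:C ((enorm y)^-1 *: y) =
  kcharge rad mu (kscale (sphere_area R n)^-1 (second_kind_kernel a)) y +i*
  kcharge rad mu (kscale (sphere_area R n)^-1 (second_kind_kernel b)) y.
Proof.
move=> rP ry; have y0 : enorm y != 0 by rewrite gt_eqF// (lt_trans rad_gt0).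
pose s := enorm y ^+ n.-1; have s0 : s != 0 by rewrite expf_neq0.
rewrite /second_kind /charge_cintegral.
have -> : (fun x : borelRn R n => complex.Re ((peval P (fun i =>
      (enorm y)%:C * (((enorm y)^-1 *: y) 0 i)%:C) - pfun P x)
    / dist_ext rad ((enorm y)^-1 *: y) x (enorm y)%:C ^+ n * (enorm y)%:C ^+ n.-1))
    = kcut rad (kscale s (second_kind_kernel a)) y.
  by apply/funext => x; rewrite (second_kind_integrand _ rP).
have -> : (fun x : borelRn R n => complex.Im ((peval P (fun i =>
      (enorm y)%:C * (((enorm y)^-1 *: y) 0 i)%:C) - pfun P x)
    / dist_ext rad ((enorm y)^-1 *: y) x (enorm y)%:C ^+ n * (enorm y)%:C ^+ n.-1))
    = kcut rad (kscale s (second_kind_kernel b)) y.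
  by apply/funext => x; rewrite (second_kind_integrand _ rP).
rewrite -!/(kcharge rad mu _ y) !kchargeZ//.
rewrite -exprVn -fmorphV -rmorphXn/= exprVn -/s.
by simpc; congr (_ +i* _); rewrite mulrCA mulKf.
Qed.

End SecondKind.

Theorem corollary12 (R : realType) (n : nat) (n_gt0 : (0 < n)%N)
    (rad : R) (rad_gt0 : 0 < rad) (P : cpoly R n)
    (mu : {charge set (borelRn R n) -> \bar R})
    (mu_supp : charge_support mu `<=` [set x | enorm x <= rad]) :
  polyharmonic_on [set y : 'rV[R]_n | rad < enorm y] (poly_degree_sup P)
    (fun y => (enorm y)%:C ^- n.-1 *
              second_kind rad mu P (enorm y)%:C ((enorm y)^-1 *: y)).
Proof.
have [a [b rP]] := represents_pfun P; have [pa [pb _]] := rP.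
set N := poly_degree_sup P.
have kill (c : kexpr R n) : kpoly c ->
    (forall h, kpoly h -> keq (klap h) (KConst 0) ->
      keq (klapn N.+1 (KMul c h)) (KConst 0)) ->
    keq (klapn N (kscale (sphere_area R n)^-1 (second_kind_kernel c))) (KConst 0).
  move=> pc hc x y yx; rewrite (klapnZ _ _ (kscalarC _) yx) kevM.
  by rewrite (kernel_polyharmonic pc hc yx) mulr0.
have ka := kill a pa (fun h ph h0 => (poly_degree_supP n_gt0 rP ph h0).1).
have kb := kill b pb (fun h ph h0 => (poly_degree_supP n_gt0 rP ph h0).2).
set f := (X in polyharmonic_on _ _ X).
have fE y (ry : rad < enorm y) := second_kindE n_gt0 rad_gt0 mu rP ry.
have [Ca La] : (forall k, Ck_on k [set y | rad < enorm y]
      (fun y => complex.Re (f y))) /\ forall y, rad < enorm y ->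
    iter N (@real_laplacian R n) (fun y => complex.Re (f y)) y = 0.
  by apply: kcharge_polyharmonic ka => y ry; rewrite /f fE.
have [Cb Lb] : (forall k, Ck_on k [set y | rad < enorm y]
      (fun y => complex.Im (f y))) /\ forall y, rad < enorm y ->
    iter N (@real_laplacian R n) (fun y => complex.Im (f y)) y = 0.
  by apply: kcharge_polyharmonic kb => y ry; rewrite /f fE.
split=> [k|y ry]; first by split.
by rewrite iter_laplacianE La// Lb.
Qed.
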